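(* Let $\mathcal{H}$ be a Hilbert space, $\Lambda$ an index set, $q=\{q_{\alpha\beta}\in\mathbb{T}:\alpha\ne\beta\in\Lambda\}$ with $q_{\alpha\beta}=q_{\beta\alpha}^{-1}$, and $\mathcal{T}=\{T_\alpha:\alpha\in\Lambda\}$ a family of contractions on $\mathcal{H}$ with $T_\alpha T_\beta=q_{\alpha\beta}T_\beta T_\alpha$ for all $\alpha\ne\beta$. Suppose one of the following holds: (1) every $T_\alpha$ is an isometry; (2) additionally $T_\alpha T_\beta^*=\overline{q_{\alpha\beta}}\,T_\beta^*T_\alpha$ for all $\alpha\ne\beta$; (3) $\Lambda$ is countable and $\sum_{\alpha\in\Lambda}\|T_\alpha\|^2\le1$. Then there exist a Hilbert space $\mathcal{K}\supseteq\mathcal{H}$ and unitaries $\{U_\alpha:\alpha\in\Lambda\}$ on $\mathcal{K}$ with $U_\alpha U_\beta=q_{\alpha\beta}U_\beta U_\alpha$ for all $\alpha\ne\beta$ such that \[ T_{\alpha_1}^{m_{\alpha_1}}\cdots T_{\alpha_k}^{m_{\alpha_k}}=P_{\mathcal{H}}U_{\alpha_1}^{m_{\alpha_1}}\cdots U_{\alpha_k}^{m_{\alpha_k}}|_{\mathcal{H}} \] for every $k$, all distinct $\alpha_1,\dots,\alpha_k\in\Lambda$ and all $m_{\alpha_1},\dots,m_{\alpha_k}\in\mathbb{N}\cup\{0\}$.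
   Context: $P_{\mathcal{H}}$ denotes the orthogonal projection of $\mathcal{K}$ onto $\mathcal{H}$. *)

(* Defs.v *)
From HB Require Import structures.
From mathcomp Require Import all_boot all_order all_algebra.
From mathcomp Require Import all_classical all_reals.
From mathcomp Require Import complex.
From Stdlib Require List.
Set Implicit Arguments. Unset Strict Implicit. Unset Printing Implicit Defensive.
Import Order.TTheory GRing.Theory Num.Theory ComplexField.
Local Open Scope ring_scope.
Local Open Scope complex_scope.

Record hilbert (R : realType) := Hilbert {
  hcarrier :> lmodType R[i];
  ip : hcarrier -> hcarrier -> R[i];
  ip_linl : forall (a : R[i]) (x y z : hcarrier), ip (a *: x + y) z = a * ip x z + ip y z;
  ip_conj : forall x y : hcarrier, ip y x = (ip x y)^*;
  ip_ge0 : forall x : hcarrier, 0 <= ip x x;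
  ip_eq0 : forall x : hcarrier, ip x x = 0 -> x = 0;
  ip_complete : forall u : nat -> hcarrier,
    (forall e : R, 0 < e -> exists N, forall m n, (N <= m)%N -> (N <= n)%N ->
        Num.sqrt (complex.Re (ip (u m - u n) (u m - u n))) < e) ->
    exists l : hcarrier, forall e : R, 0 < e -> exists N, forall n, (N <= n)%N ->
        Num.sqrt (complex.Re (ip (u n - l) (u n - l))) < e
}.

Section Ops.
Variable R : realType.

Definition hnorm (H : hilbert R) (x : H) : R := Num.sqrt (complex.Re (ip x x)).

Definition is_linear (H K : hilbert R) (f : H -> K) : Prop :=
  forall (a : R[i]) (x y : H), f (a *: x + y) = a *: f x + f y.

Definition contraction (H : hilbert R) (T : H -> H) : Prop :=
  is_linear T /\ forall x, hnorm (T x) <= hnorm x.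

Definition isometry_op (H K : hilbert R) (V : H -> K) : Prop :=
  is_linear V /\ forall x y, ip (V x) (V y) = ip x y.

Definition unitary (H : hilbert R) (U : H -> H) : Prop :=
  isometry_op U /\ forall y, exists x, U x = y.

Definition is_adjoint (H K : hilbert R) (T : H -> K) (S : K -> H) : Prop :=
  forall x y, ip (T x) y = ip x (S y).

Definition opnorm (H : hilbert R) (T : H -> H) : R :=
  inf [set c : R | 0 <= c /\ forall x, hnorm (T x) <= c * hnorm x]%classic.

(* ordered product  A_{a1}^{m1} ... A_{ak}^{mk}  for s = [(a1,m1);...;(ak,mk)] *)
Definition word_op (H : hilbert R) (Lam : Type) (A : Lam -> H -> H)
  (s : seq (Lam * nat)%type) : H -> H :=
  foldr (fun p acc => iter p.2 (A p.1) \o acc) id s.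

Definition q_commuting (H : hilbert R) (Lam : Type) (q : Lam -> Lam -> R[i])
  (A : Lam -> H -> H) : Prop :=
  forall a b, a <> b -> forall x, A a (A b x) = q a b *: A b (A a x).

End Ops.

(* Main.v *)
(* Regular dilation in the sense of Brehmer. Choose unimodular numbers chi(a,b) with
   chi(a,b) = q(a,b) chi(b,a); they define a bicharacter c on the group of finitely
   supported functions L -> Z, and products of the T_a, corrected by a phase, become
   operators T^r (r >= 0) with T_a T^r = c(e_a, r) T^(r + e_a). The kernel
     ((m,x), (n,y)) |-> conj c(p,m) c(p,n) <T^(m-p) x, T^(n-p) y>,   p = min(m,n),
   is invariant under (m,x) |-> (m + e_a, c(e_a,m) x). If it is positive semidefinite, the
   Hilbert space it generates carries q-commuting unitaries U_a inducing these shifts; the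
   vectors (0,x) form a copy of H, and the compression of a positive word in the U_a is the
   same word in the T_a.

   Positivity holds as soon as every form
     beta_F(x,y) = sum_(G subset F) (-1)^|G| <T_G x, T_G y>   (F finite)
   is positive: since beta_F(x,y) = beta_F(T_a x, T_a y) + beta_(F,a)(x,y), lowering p one
   coordinate at a time writes the kernel as a sum of forms beta_F evaluated on vectors
   that split into an m-part and an n-part. For isometries beta_F = 0 unless F is empty.
   For row contractions |x|^2 - sum_F |T_a x|^2 <= beta_F(x,x) <= |x|^2 by induction. In the
   doubly q-commuting case T_a has the beta_F-adjoint T_a^*, so it is beta_F-contractive. *)
Require Import Defs.
From HB Require Import structures.
From mathcomp Require Import all_boot all_order all_algebra.
From mathcomp Require Import all_classical all_reals.
From mathcomp Require Import complex.
From mathcomp Require Import ring lra wochoice.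
From Stdlib Require List.
Import Order.TTheory GRing.Theory Num.Theory ComplexField.
(* With ring_scope on top, x^* parses as Num.conj x, to which conjc x is convertible. *)
Local Open Scope complex_scope.
Local Open Scope ring_scope.

Set Implicit Arguments. Unset Strict Implicit. Unset Printing Implicit Defensive.

(** * Limits of complex sequences *)

Section ComplexNumbers.
Variable R : realType.
Local Notation C := R[i].
Implicit Types (z w : C) (e : R).

Lemma ge0_complexE z : 0 <= z -> z = (complex.Re z)%:C.
Proof. by case: z => a b /ger0_Im /= ->. Qed.

Lemma Re_ge0 z : 0 <= z -> 0 <= complex.Re z.
Proof. by rewrite lecE => /andP[]. Qed.

Lemma sqr_normcD z w : `|z + w| ^+ 2 <= 2 * `|z| ^+ 2 + 2 * `|w| ^+ 2.
Proof.
rewrite -subr_ge0.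
suff -> : 2 * `|z| ^+ 2 + 2 * `|w| ^+ 2 - `|z + w| ^+ 2 = `|z - w| ^+ 2.
  exact: exprn_ge0.
by rewrite !normCK rmorphD rmorphB /=; ring.
Qed.

Lemma sqr_normcB z w : `|z - w| ^+ 2 <= 2 * `|z| ^+ 2 + 2 * `|w| ^+ 2.
Proof. by rewrite -(normrN w); exact: sqr_normcD. Qed.

Lemma le_eps_eq0 z w : 0 <= z -> 0 <= w ->
  (forall e, 0 < e -> z <= e%:C * w) -> z = 0.
Proof.
move=> z0 w0 h; move: (Re_ge0 w0) h.
rewrite (ge0_complexE z0) (ge0_complexE w0) /=.
set a := complex.Re z; set b := complex.Re w => b0 h; congr (_%:C).
apply/eqP; rewrite eq_le {2}/a (Re_ge0 z0) andbT leNgt; apply/negP => a0.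
have b1 : 0 < 2 * (b + 1) by lra.
have := h (a / (2 * (b + 1))) (divr_gt0 a0 b1).
rewrite -rmorphM lecR mulrAC ler_pdivlMr //; nra.
Qed.

(* The discriminant of a nonnegative hermitian form in two variables. *)
Lemma sqr_normc_le_of_hermitian (p r z : C) : 0 <= p -> 0 <= r ->
  (forall a : C, 0 <= p + a * z^* + a^* * z + a * a^* * r) -> `|z| ^+ 2 <= p * r.
Proof.
move=> p0 r0 h; have [r00|rn0] := eqVneq r 0.
  rewrite r00 mulr0; have [->|z0] := eqVneq z 0; first by rewrite normr0 expr0n.
  have w0 : 0 < `|z| ^+ 2 by rewrite exprn_gt0 // normr_gt0.
  (* With [r = 0] the form at [- t * z] equals [p - 2 t |z|^2]; this [t] makes it -1. *)
  pose t := (p + 1) / (2 * `|z| ^+ 2).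
  have tJ : t^* = t.
    by apply: geC0_conj; rewrite divr_ge0 ?addr_ge0 ?mulr_ge0 // ltW.
  have := h (- t * z).
  rewrite r00 mulr0 addr0 rmorphM rmorphN /= tJ.
  rewrite -!(mulrA (- t)) [z^* * z]mulrC -normCK.
  set w := `|z| ^+ 2 in w0 t tJ *.
  have -> : p + - t * w + - t * w = - 1.
    by rewrite /t; field; rewrite gt_eqF.
  by rewrite oppr_ge0 ler10.
have rp : 0 < r by rewrite lt_def rn0.
(* The minimiser in [a], where the form takes the value [p - |z|^2 / r]. *)
have := h (- (r^-1 * z)).
rewrite rmorphN rmorphM /= (geC0_conj (_ : 0 <= r^-1)) ?invr_ge0 //.
have -> : p + - (r^-1 * z) * z^* + - (r^-1 * z^*) * z +
   - (r^-1 * z) * - (r^-1 * z^*) * r = p - `|z| ^+ 2 / r.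
  by rewrite normCK; field.
by rewrite subr_ge0 ler_pdivrMr.
Qed.

Definition limC (u : nat -> C) l :=
  forall e, 0 < e -> exists N, forall n, (N <= n)%N -> `|u n - l| <= e%:C.

Lemma inv_nat_small e : 0 < e -> exists N, forall n, (N <= n)%N -> n.+1%:R^-1 <= e.
Proof.
move=> e0; exists (Num.Def.truncn e^-1) => n hn.
rewrite invf_ple ?posrE // ltW // (lt_le_trans (truncnS_gt _)) //.
by rewrite ler_nat ltnS.
Qed.

Lemma limC_unique u l l' : limC u l -> limC u l' -> l = l'.
Proof.
move=> h h'; apply/eqP; rewrite -subr_eq0 -normr_eq0; apply/eqP.
apply: (@le_eps_eq0 _ 2) => // e e0.
have [N hN] := h _ e0; have [N' hN'] := h' _ e0.
have := hN (maxn N N') (leq_maxl _ _); have := hN' (maxn N N') (leq_maxr _ _).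
set v := u _ => a b; have -> : l - l' = (v - l') - (v - l) by ring.
by apply: le_trans (ler_normB _ _) _; rewrite mulr_natr mulr2n lerD.
Qed.

Lemma limC_cst c : limC (fun _ => c) c.
Proof. by move=> e e0; exists 0%N => n _; rewrite subrr normr0 ltW // ltcR. Qed.

Lemma eq_limC u v l : u =1 v -> limC u l -> limC v l.
Proof. by move=> /funext ->. Qed.

Lemma limCD u v l k : limC u l -> limC v k -> limC (fun n => u n + v n) (l + k).
Proof.
move=> h h' e e0; have e2 : 0 < e / 2 by lra.
have [N hN] := h _ e2; have [N' hN'] := h' _ e2.
exists (maxn N N') => n; rewrite geq_max => /andP[n1 n2].
have -> : u n + v n - (l + k) = (u n - l) + (v n - k) by ring.
apply: le_trans (ler_normD _ _) _; apply: le_trans (lerD (hN _ n1) (hN' _ n2)) _.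
by rewrite -rmorphD lecR; lra.
Qed.

Lemma limCZ c u l : limC u l -> limC (fun n => c * u n) (c * l).
Proof.
move=> h e e0; set M := complex.Re `|c| + 1.
have cE : `|c| = (complex.Re `|c|)%:C by apply: ge0_complexE.
have M0 : 0 < M by rewrite /M ltr_wpDl // Re_ge0.
have [N hN] := h _ (divr_gt0 e0 M0); exists N => n /hN.
rewrite -mulrBr normrM => le; apply: (@le_trans _ _ (M%:C * (e / M)%:C)).
  by apply: ler_pM => //; rewrite cE lecR /M lerDl.
by rewrite -rmorphM lecR mulrC divfK // gt_eqF.
Qed.

Lemma limC_conj u l : limC u l -> limC (fun n => (u n)^*) l^*.
Proof.
by move=> h e /h[N hN]; exists N => n /hN; rewrite -rmorphB norm_conjC.
Qed.

Lemma limC_squeeze u v l : limC u l -> limC (fun n => v n - u n) 0 -> limC v l.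
Proof.
move=> h1 h2; have := limCD h1 h2; rewrite addr0; apply: eq_limC => n.
by rewrite addrC subrK.
Qed.

(* Real limit of a Cauchy sequence: the supremum of its eventual lower bounds. *)
Lemma cauchy_real_limit (u : nat -> R) :
  (forall e, 0 < e -> exists N, forall m n, (N <= m)%N -> (N <= n)%N ->
     `|u m - u n| <= e) ->
  exists l, forall e, 0 < e -> exists N, forall n, (N <= n)%N -> `|u n - l| <= e.
Proof.
move=> cu; pose A := [set x | exists N, forall n, (N <= n)%N -> x <= u n]%classic.
have key e N : 0 < e ->
    (forall m n, (N <= m)%N -> (N <= n)%N -> `|u m - u n| <= e) ->
    A (u N - e) /\ ubound A (u N + e).
  move=> e0 hN; split; first by exists N => n Nn; have := hN N n (leqnn _) Nn;
    rewrite ler_norml => /andP[]; lra.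
  move=> x [N' h']; have := h' (maxn N N') (leq_maxr _ _).
  have := hN N (maxn N N') (leqnn _) (leq_maxl _ _).
  by rewrite ler_norml => /andP[]; lra.
have [N0 /(key _ _ ltr01)[A0 B0]] := cu 1 ltr01.
have sA : has_sup A by split; [exists (u N0 - 1)|exists (u N0 + 1)].
exists (sup A) => e e0; have e2 : 0 < e / 2 by lra.
have [N hN] := cu _ e2; have [a b] := key _ _ e2 hN.
have lo := sup_ubound sA.2 a; have hi : sup A <= u N + e / 2.
  by apply: ge_sup => //; exists (u N0 - 1).
exists N => n Nn; have := hN N n (leqnn _) Nn; rewrite !ler_norml => /andP[c d].
by apply/andP; split; lra.
Qed.

Lemma cauchy_limC (u : nat -> C) :
  (forall e, 0 < e -> exists N, forall m n, (N <= m)%N -> (N <= n)%N ->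
     `|u m - u n| <= e%:C) -> exists l, limC u l.
Proof.
move=> cu.
have part (f : C -> R) : (forall z w, `|f z - f w|%:C <= `|z - w|) ->
    exists l, forall e, 0 < e -> exists N, forall n, (N <= n)%N -> `|f (u n) - l| <= e.
  move=> hf; apply: cauchy_real_limit => e /cu[N hN]; exists N => m n hm hn.
  by rewrite -lecR; apply: le_trans (hN _ _ hm hn).
have [a ha] : exists l, forall e, 0 < e -> exists N, forall n, (N <= n)%N ->
    `|complex.Re (u n) - l| <= e.
  by apply: part => z w; apply: le_trans (normc_ge_Re _); case: z w => ? ? [].
have [b hb] : exists l, forall e, 0 < e -> exists N, forall n, (N <= n)%N ->
    `|complex.Im (u n) - l| <= e.
  (* Multiplication by ['i] turns imaginary parts, up to sign, into real parts and keeps the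
     modulus. *)
  apply: part => z w; rewrite -(normrN (z - w)).
  have -> : `| - (z - w)| = `|(z - w) * 'i| :> C.
    by rewrite normrN normrM normCi mulr1.
  apply: le_trans (normc_ge_Re _); rewrite ReiNIm normrN.
  by case: z w => ? ? [].
exists (a +i* b) => e e0; have e2 : 0 < e / 2 by lra.
have [N hN] := ha _ e2; have [N' hN'] := hb _ e2.
exists (maxn N N') => n; rewrite geq_max => /andP[/hN h1 /hN' h2].
have -> : u n - (a +i* b) =
    (complex.Re (u n) - a)%:C + 'i * (complex.Im (u n) - b)%:C.
  by case: (u n) => x y; simpc.
apply: le_trans (ler_normD _ _) _; rewrite normrM normCi mul1r.
have nr (x : R) : `|x%:C| = `|x|%:C.
  by rewrite normc_def /= expr0n addr0 sqrtr_sqr.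
rewrite !nr -rmorphD lecR; lra.
Qed.

(** Positivity at every [a *: y + x] is the hypothesis of the discriminant bound. The form may be
    degenerate, as Brehmer forms often are. *)
Lemma cauchy_schwarz_form (V : lmodType C) (b : V -> V -> C) :
  (forall a (x y v : V), b (a *: x + y) v = a * b x v + b y v) ->
  (forall x y, b y x = (b x y)^*) -> (forall x, 0 <= b x x) ->
  forall x y, `|b x y| ^+ 2 <= b x x * b y y.
Proof.
move=> bl bC b0 x y; apply: sqr_normc_le_of_hermitian => // a.
rewrite -bC; set s := (X in 0 <= X).
suff -> : s = b (a *: y + x) (a *: y + x) by [].
have br (v : V) : b v (a *: y + x) = a^* * b v y + b v x.
  by rewrite bC bl rmorphD rmorphM /= -!bC.
by rewrite /s !bl !br; ring.
Qed.

End ComplexNumbers.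

(** * Riesz representation and adjoints *)

Section HilbertBasics.
Variables (R : realType) (H : hilbert R).
Local Notation C := R[i].
Implicit Types (x y z : H) (a : C).

Lemma ipC x y : ip y x = (ip x y)^*. Proof. exact: ip_conj. Qed.

Lemma ipDl x y z : ip (x + y) z = ip x z + ip y z.
Proof. by rewrite -[x]scale1r ip_linl mul1r scale1r. Qed.

Lemma ip0l z : ip 0 z = 0.
Proof. by apply: (addrI (ip 0 z)); rewrite -ipDl !addr0. Qed.

Lemma ipZl a x z : ip (a *: x) z = a * ip x z.
Proof. by rewrite -[a *: x]addr0 ip_linl ip0l addr0. Qed.

Lemma ipNl x z : ip (- x) z = - ip x z.
Proof. by rewrite -scaleN1r ipZl mulN1r. Qed.

Lemma ipDr x y z : ip z (x + y) = ip z x + ip z y.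
Proof. by rewrite ipC ipDl rmorphD /= -!ipC. Qed.

Lemma ipZr a x z : ip z (a *: x) = a^* * ip z x.
Proof. by rewrite ipC ipZl rmorphM /= -ipC. Qed.

Lemma ipNr x z : ip z (- x) = - ip z x.
Proof. by rewrite ipC ipNl rmorphN /= -ipC. Qed.

Lemma ipBr x y z : ip z (x - y) = ip z x - ip z y.
Proof. by rewrite ipDr ipNr. Qed.

Lemma ip_ext x y : (forall z, ip z x = ip z y) -> x = y.
Proof.
move=> h; apply/eqP; rewrite -subr_eq0; apply/eqP/ip_eq0.
by rewrite ipBr h subrr.
Qed.

Lemma cauchy_schwarz x y : `|ip x y| ^+ 2 <= ip x x * ip y y.
Proof. exact: cauchy_schwarz_form (@ip_linl _ H) ipC (@ip_ge0 _ H) x y. Qed.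

Lemma sqrt_Re_lt (z : C) (e : R) : 0 <= z -> 0 < e ->
  (Num.sqrt (complex.Re z) < e) = (z < (e ^+ 2)%:C).
Proof.
move=> z0 e0; rewrite {2}(ge0_complexE z0) ltcR.
by rewrite -(ltr_pXn2r (_ : (0 < 2)%N)) ?nnegrE ?sqrtr_ge0 ?ltW // sqr_sqrtr ?Re_ge0.
Qed.

Definition hlim (u : nat -> H) l :=
  forall e : R, 0 < e -> exists N, forall n, (N <= n)%N ->
    ip (u n - l) (u n - l) <= e%:C.

Lemma cauchy_hlim (u : nat -> H) :
  (forall e : R, 0 < e -> exists N, forall m n, (N <= m)%N -> (N <= n)%N ->
    ip (u m - u n) (u m - u n) <= e%:C) -> exists l, hlim u l.
Proof.
move=> cu; have [e e0|l hl] := @ip_complete _ H u.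
  have [|N hN] := cu (e ^+ 2 / 2); first by rewrite divr_gt0 // exprn_gt0.
  exists N => m n hm hn; rewrite sqrt_Re_lt ?ip_ge0 //.
  apply: le_lt_trans (hN _ _ hm hn) _; rewrite ltcR ltr_pdivrMr //.
  by rewrite ltr_pMr ?exprn_gt0 // ltr1n.
exists l => e e0; have s0 : 0 < Num.sqrt e by rewrite sqrtr_gt0.
have [N hN] := hl _ s0; exists N => n /hN; rewrite sqrt_Re_lt ?ip_ge0 //.
by rewrite sqr_sqrtr; [move/ltW|exact: ltW].
Qed.

(* The norm-squared gap of an almost minimiser of |x|^2 - 2 Re f(x) controls its
   distance to f as a functional. *)
Lemma riesz_approx (f : H -> C) (M e : R) :
  (forall a x y, f (a *: x + y) = a * f x + f y) ->
  0 <= M -> (forall x, `|f x| ^+ 2 <= M%:C * ip x x) -> 0 < e ->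
  exists y, forall x, `|ip x y - f x| ^+ 2 <= e%:C * ip x x.
Proof.
move=> fl M0 fM e0; pose Phi x := complex.Re (ip x x - (f x + f x)).
have f_ge x : - M <= Phi x.
  rewrite /Phi raddfB raddfD /=.
  have := fM x; rewrite (ge0_complexE (ip_ge0 x)) -add_Re2_Im2 -rmorphM lecR.
  have := Re_ge0 (ip_ge0 x).
  case: (f x) => u v /=; set s := complex.Re _ => s0 hs.
  rewrite leNgt; apply/negP => lt.
  (* From [2u > s + M] follows [4u^2 > (s + M)^2 >= 4Ms], against [u^2 + v^2 <= Ms]. *)
  have : 0 < (u + u - (s + M)) * (u + u + (s + M)) by apply: mulr_gt0; lra.
  by have := sqr_ge0 (s - M); have := sqr_ge0 v; nra.
have sE : has_inf [set Phi x | x in [set: H]]%classic.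
  split; first by exists (Phi 0), 0.
  by exists (- M) => _ [x _ <-].
have [_ [y _ <-] hy] := inf_adherent e0 sE.
exists y => x.
have gl a : ip (a *: x) y - f (a *: x) = a * (ip x y - f x).
  have f0 : f 0 = 0.
    by apply: (addrI (f 0)); have := fl 1 0 0; rewrite scaler0 mul1r !addr0 => <-.
  by have := fl a x 0; rewrite f0 !addr0 ipZl mulrBr => ->.
(* [Phi (y + a *: x) - Phi y] is a hermitian polynomial in [a] that stays above [- e]; after adding
   [e] its discriminant gives the bound. *)
rewrite -(norm_conjC (_ - _)); apply: sqr_normc_le_of_hermitian => [||a].
- by rewrite ler0c ltW.
- exact: ip_ge0.
have hI : inf [set Phi x | x in [set: H]]%classic <= Phi (y + a *: x).
  by apply: ge_inf; [exact: sE.2|exists (y + a *: x)].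
have fD : f (y + a *: x) = f y + f (a *: x).
  by rewrite -{1}[y]scale1r fl mul1r.
have PhiE : ((Phi (y + a *: x) - Phi y)%:C : C) =
    a * (ip x y - f x) + (a * (ip x y - f x))^* + a * a^* * ip x x.
  rewrite -gl /Phi fD.
  set z := f (a *: x); set w := f y.
  rewrite ipDl !ipDr [ip y (a *: x)]ipC rmorphB /= -mulrA -ipZr -ipZl.
  have := ger0_Im (ip_ge0 (a *: x)); case: (ip (a *: x) (a *: x)) => p q /= ->.
  case: (ip (a *: x) y) => ? ?; case: z => ? ?; case: w => ? ?.
  case: (ip y y) => ? ?; simpc => /=.
  by congr (_ +i* _); ring.
rewrite conjCK -!addrA.
suff : - e%:C <= (Phi (y + a *: x) - Phi y)%:C :> C.
  by rewrite PhiE rmorphM /= -(lerD2l e%:C) subrr !addrA.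
by rewrite -rmorphN lecR; lra.
Qed.

Lemma riesz (f : H -> C) (M : R) :
  (forall a x y, f (a *: x + y) = a * f x + f y) ->
  0 <= M -> (forall x, `|f x| ^+ 2 <= M%:C * ip x x) ->
  exists y, forall x, f x = ip x y.
Proof.
move=> fl M0 fM.
have /choice[u hu] (n : nat) :
    exists y, forall x, `|ip x y - f x| ^+ 2 <= (n.+1%:R^-1 : R)%:C * ip x x.
  by apply: (riesz_approx fl M0 fM); rewrite invr_gt0.
have hu' (e : R) : 0 < e -> exists N, forall n, (N <= n)%N ->
    forall x, `|ip x (u n) - f x| ^+ 2 <= e%:C * ip x x.
  move=> /inv_nat_small[N hN]; exists N => n /hN le x; apply: le_trans (hu n x) _.
  by rewrite ler_wpM2r ?ip_ge0 // lecR.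
have [|l hl] := @cauchy_hlim u.
  move=> e e0; have e4 : 0 < e / 4 by lra.
  have [N hN] := hu' _ e4; exists N => m n hm hn.
  (* Testing both approximations on the difference [h] itself gives
     [<h,h>^2 <= 2 (e/4 + e/4) <h,h>]. *)
  set h := u m - u n; have [-> //|h0] := eqVneq (ip h h) 0.
    by rewrite ler0c ltW.
  have hp : 0 < ip h h by rewrite lt_def h0 ip_ge0.
  rewrite -(ler_pM2r hp).
  have -> : ip h h * ip h h = `|(ip h (u m) - f h) - (ip h (u n) - f h)| ^+ 2.
    have -> : (ip h (u m) - f h) - (ip h (u n) - f h) = ip h h.
      by rewrite [in RHS]/h ipBr; ring.
    by rewrite ger0_norm ?ip_ge0 // expr2.
  apply: le_trans (sqr_normcB _ _) _.
  have := lerD (hN m hm h) (hN n hn h); rewrite -(ler_pM2l (_ : 0 < 2 :> C)) //.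
  rewrite mulrDr => /le_trans; apply.
  rewrite -mulrDl mulrA -rmorphD -(rmorph_nat (real_complex R) 2) -rmorphM.
  rewrite ler_wpM2r ?ip_ge0 // lecR; lra.
exists l => x; apply/eqP; rewrite -subr_eq0 -normr_eq0 -sqrf_eq0; apply/eqP.
apply: (le_eps_eq0 (w := ip x x)) => [||e e0]; rewrite ?exprn_ge0 ?ip_ge0 //.
have e4 : 0 < e / 4 by lra.
have [N hN] := hu' _ e4; have [N' hN'] := hl _ e4.
set n := maxn N N'; have {}hN := hN n (leq_maxl _ _) x.
have {}hN' := hN' n (leq_maxr _ _).
have -> : f x - ip x l = ip x (u n - l) - (ip x (u n) - f x).
  by rewrite ipBr; ring.
apply: le_trans (sqr_normcB _ _) _.
have h1 : `|ip x (u n - l)| ^+ 2 <= (e / 4)%:C * ip x x.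
  apply: le_trans (cauchy_schwarz _ _) _.
  by rewrite mulrC ler_wpM2r ?ip_ge0.
rewrite -mulrDr; apply: le_trans (ler_wpM2l _ (lerD h1 hN)) _ => //.
rewrite -mulrDl mulrA -rmorphD -(rmorph_nat (real_complex R) 2) -rmorphM.
by rewrite ler_wpM2r ?ip_ge0 // lecR; lra.
Qed.

End HilbertBasics.

Section Adjoints.
Variable R : realType.
Local Notation C := R[i].

Lemma is_linearZ (H K : hilbert R) (f : H -> K) (c : C) (x : H) :
  is_linear f -> f (c *: x) = c *: f x.
Proof.
move=> fl; have f0 : f 0 = 0.
  by apply: (addrI (f 0)); have := fl 1 0 0; rewrite !scale1r !addr0.
by have := fl c x 0; rewrite !addr0 f0 addr0.
Qed.

(** Represent [x |-> <T x, y>] by Riesz. This supplies the adjoints of the [T a] in the doubly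
    commuting case, and the adjoint of the embedding of [H] into the dilation space. *)
Lemma adjoint_exists (H K : hilbert R) (T : H -> K) : is_linear T ->
  (forall x, ip (T x) (T x) <= ip x x) -> exists S, is_adjoint T S.
Proof.
move=> Tl Tc.
have /choice[S hS] (y : K) : exists z, forall x, ip (T x) y = ip x z.
  apply: (@riesz _ _ (fun x => ip (T x) y) (complex.Re (ip y y))).
  - by move=> a x z; rewrite Tl ipDl ipZl.
  - exact/Re_ge0/ip_ge0.
  - move=> x; rewrite -ge0_complexE ?ip_ge0 // mulrC.
    apply: le_trans (cauchy_schwarz _ _) _.
    by rewrite ler_wpM2r ?ip_ge0.
by exists S => x y; exact: hS.
Qed.

Lemma hnorm_leE (H : hilbert R) (x y : H) :
  (hnorm x <= hnorm y) = (ip x x <= ip y y).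
Proof.
rewrite /hnorm ler_sqrt ?Re_ge0 ?ip_ge0 //.
by rewrite [in RHS](ge0_complexE (ip_ge0 x)) [in RHS](ge0_complexE (ip_ge0 y)) lecR.
Qed.

End Adjoints.

(** * Inequalities preserved by limits *)

Section LimitInequalities.
Variable R : realType.
Local Notation C := R[i].

Lemma limC_norm (u : nat -> C) l : limC u l -> limC (fun n => `|u n|) `|l|.
Proof.
move=> h e /h[N hN]; exists N => n /hN; apply: le_trans.
exact: ler_dist_dist.
Qed.

(** Nonnegativity of a complex number is the equation [|l| = l], which passes to limits and also
    controls the imaginary part. *)
Lemma limC_ge0 (u : nat -> C) l : limC u l ->
  (exists N, forall n, (N <= n)%N -> 0 <= u n) -> 0 <= l.
Proof.
move=> h [N hN].
have : limC (fun n => `|u n| - u n) (`|l| - l).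
  rewrite -(mulN1r l); apply: limCD (limC_norm h) _.
  by apply: eq_limC (limCZ (-1) h) => n; rewrite mulN1r.
have h0 : limC (fun n => `|u n| - u n) 0.
  move=> e e0; exists N => n /hN un; rewrite (ger0_norm un) subrr subr0 normr0.
  by rewrite ler0c ltW.
by move=> /(limC_unique h0)/esym/eqP; rewrite subr_eq0 => /eqP <-.
Qed.

Lemma limC_le (u : nat -> C) l (c : C) : limC u l ->
  (exists N, forall n, (N <= n)%N -> u n <= c) -> l <= c.
Proof.
move=> h [N hN]; rewrite -subr_ge0.
apply: (@limC_ge0 (fun n => c + -1 * u n)).
  rewrite -(mulN1r l); apply: (limCD (u := fun=> c)) (limCZ _ h).
  exact: limC_cst.
by exists N => n /hN; rewrite mulN1r subr_ge0.
Qed.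

Lemma limC_sqr_norm_le (u : nat -> C) l (c : C) : limC u l -> 0 <= c ->
  (exists N, forall n, (N <= n)%N -> `|u n| ^+ 2 <= c) -> `|l| ^+ 2 <= c.
Proof.
move=> h c0 [N hN]; rewrite -[c]sqrtCK.
rewrite ler_pXn2r ?nnegrE ?sqrtC_ge0 //; apply: limC_le (limC_norm h) _.
exists N => n /hN; rewrite -{1}[c]sqrtCK.
by rewrite ler_pXn2r ?nnegrE ?sqrtC_ge0.
Qed.

Lemma sqr_norm_le (z : C) (e : R) : 0 <= e ->
  (`|z| ^+ 2 <= (e ^+ 2)%:C) = (`|z| <= e%:C).
Proof. move=> e0; rewrite rmorphXn /=. by rewrite ler_pXn2r ?nnegrE ?normr_ge0 ?ler0c. Qed.

End LimitInequalities.

(** * The Hilbert space of a positive semidefinite kernel *)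

Section KernelSpace.
Variables (R : realType) (D : Type) (k : D -> D -> R[i]).
Local Notation C := R[i].
Hypothesis kC : forall x y, k y x = (k x y)^*.
Hypothesis k_ge0 : forall u : seq (C * D),
  0 <= \sum_(p <- u) \sum_(r <- u) p.1 * (r.1)^* * k p.2 r.2.
Implicit Types (f g : D -> C^o) (u v : seq (C * D)) (e M : R).

(** By the reproducing property, this is what the inner product of [f] with [kcomb v] has to be. *)
Definition pairing f v : C := \sum_(p <- v) (p.1)^* * f p.2.
Definition kcomb u : D -> C^o := fun d => \sum_(p <- u) p.1 * k p.2 d.
Definition kscale (a : C) u := [seq (a * p.1, p.2) | p <- u].
Definition kform u v := pairing (kcomb u) v.

Lemma pairingP a f g v : pairing (a *: f + g) v = a * pairing f v + pairing g v.
Proof.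
rewrite /pairing mulr_sumr -big_split; apply: eq_bigr => p _ /=.
rewrite -[(a *: f + g) _]/(a * f p.2 + g p.2); ring.
Qed.

Lemma pairingB f g v : pairing (f - g) v = pairing f v - pairing g v.
Proof. by rewrite addrC -scaleN1r pairingP mulN1r addrC. Qed.

Lemma pairing_cat f u v : pairing f (u ++ v) = pairing f u + pairing f v.
Proof. exact: big_cat. Qed.

Lemma pairing_scale f a v : pairing f (kscale a v) = a^* * pairing f v.
Proof.
rewrite /pairing big_map mulr_sumr; apply: eq_bigr => p _ /=.
by rewrite rmorphM mulrA.
Qed.

Lemma kcombP a u v : kcomb (kscale a u ++ v) = a *: kcomb u + kcomb v.
Proof.
apply/funext => d.
rewrite -[RHS]/(a * kcomb u d + kcomb v d) /kcomb big_cat big_map mulr_sumr.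
by congr (_ + _); apply: eq_bigr => p _; rewrite mulrA.
Qed.

Lemma kcombB u v : kcomb (kscale (-1) v ++ u) = kcomb u - kcomb v.
Proof. by rewrite kcombP scaleN1r addrC. Qed.

Lemma kform_conj u v : kform v u = (kform u v)^*.
Proof.
rewrite /kform /pairing rmorph_sum /=.
under eq_bigr => p _ do rewrite mulr_sumr.
rewrite exchange_big; apply: eq_bigr => p _ /=.
rewrite rmorphM rmorph_sum /= conjCK mulr_sumr; apply: eq_bigr => r _.
by rewrite rmorphM /= -kC; ring.
Qed.

Lemma kform_ge0 u : 0 <= kform u u.
Proof.
have := k_ge0 u; rewrite exchange_big; set s := \sum_(_ <- _) _.
suff -> : kform u u = s by [].
rewrite /kform /pairing /s; apply: eq_bigr => p _; rewrite mulr_sumr.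
by apply: eq_bigr => r _; ring.
Qed.

Lemma kform_cauchy_schwarz u v : `|kform u v| ^+ 2 <= kform u u * kform v v.
Proof.
apply: sqr_normc_le_of_hermitian => [||a]; try exact: kform_ge0.
have := kform_ge0 (kscale a v ++ u); set s := kform _ _; set t := (X in 0 <= X -> _).
rewrite -kform_conj; suff -> : t = kform u u + a * kform v u + a^* * kform u v +
    a * a^* * kform v v by [].
by rewrite /t /s /kform kcombP pairingP !pairing_cat !pairing_scale; ring.
Qed.

(** As a functional on combinations, [f] has squared dual norm at most [M]. This replaces the norm
    of [f] until an inner product is available. *)
Definition kbounded f M := forall v, `|pairing f v| ^+ 2 <= M%:C * kform v v.

Lemma kboundedD f g e M : kbounded f e -> kbounded g M ->
  kbounded (f + g) (2 * e + 2 * M).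
Proof.
move=> hf hg v; rewrite -[f]scale1r pairingP mul1r.
apply: le_trans (sqr_normcD _ _) _.
have := lerD (hf v) (hg v); rewrite -(ler_pM2l (_ : 0 < 2 :> C)) // mulrDr.
move=> /le_trans; apply; rewrite -mulrDl mulrA -rmorphD -mulrDr rmorphM rmorph_nat.
by [].
Qed.

Lemma kboundedZ a f e : kbounded f e -> kbounded (a *: f) (complex.Re (`|a| ^+ 2) * e).
Proof.
move=> hf v; have -> : pairing (a *: f) v = a * pairing f v.
  rewrite /pairing mulr_sumr; apply: eq_bigr => p _.
  rewrite -[(a *: f) _]/(a * f p.2); ring.
rewrite normrM exprMn {1}(ge0_complexE (exprn_ge0 2 (normr_ge0 a))) rmorphM.
set N := complex.Re _; have N0 : 0 <= N by apply/Re_ge0/exprn_ge0.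
by rewrite -mulrA ler_wpM2l ?ler0c.
Qed.

Lemma kbounded_le f e M : e <= M -> kbounded f e -> kbounded f M.
Proof.
move=> le h v; apply: le_trans (h v) _.
by rewrite ler_wpM2r ?kform_ge0 // lecR.
Qed.

Lemma kboundedN f e : kbounded f e -> kbounded (- f) e.
Proof.
move=> h; rewrite -scaleN1r; have := kboundedZ (-1) h.
by rewrite normrN normr1 expr1n mul1r.
Qed.

Lemma kbounded_comb u : kbounded (kcomb u) (complex.Re (kform u u)).
Proof.
by move=> v; rewrite -ge0_complexE ?kform_ge0 //; exact: kform_cauchy_schwarz.
Qed.

(** Test the functional on [u] itself. Together with [kbounded_comb], the dual norm of a combination
    is its seminorm. *)
Lemma kbounded_comb_le u e : kbounded (kcomb u) e -> 0 <= e -> kform u u <= e%:C.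
Proof.
move=> /(_ u) h e0; have [->|n0] := eqVneq (kform u u) 0; first by rewrite ler0c.
have p0 : 0 < kform u u by rewrite lt_def n0 kform_ge0.
rewrite -(ler_pM2r p0); apply: le_trans h.
by rewrite -/(kform u u) ger0_norm ?kform_ge0 // expr2.
Qed.

(* The closure, in the dual norm of kform, of the combinations of kernel functions; the
   value f d stands for the inner product of f with the vector of d. *)
Definition kspace : {pred (D -> C^o)} :=
  fun f => `[< forall e, 0 < e -> exists u, kbounded (f - kcomb u) e >].

Lemma kspaceP f :
  reflect (forall e, 0 < e -> exists u, kbounded (f - kcomb u) e) (f \in kspace).
Proof. exact: asboolP. Qed.

Lemma kcomb_in u : kcomb u \in kspace.
Proof.
apply/kspaceP => e e0; exists u => v; rewrite subrr.
rewrite /pairing big1 ?normr0 ?expr0n ?mulr_ge0 ?kform_ge0 ?ler0c ?ltW //.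
by move=> p _; rewrite -[0 _]/(0 : C) mulr0.
Qed.

Lemma kspace_submod : GRing.submod_closed kspace.
Proof.
split.
  have -> : 0 = kcomb [::] by apply/funext => d; rewrite /kcomb big_nil.
  exact: kcomb_in.
move=> a f g /kspaceP hf /kspaceP hg; apply/kspaceP => e e0.
set N := complex.Re (`|a| ^+ 2).
have N0 : 0 <= N by apply/Re_ge0/exprn_ge0.
(* After scaling by [N] each summand contributes at most [e / 4], and [kboundedD] doubles both. *)
have d0 : 0 < e / (4 * (N + 1)) by apply: divr_gt0; lra.
have e4 : 0 < e / 4 by lra.
have [u hu] := hf _ d0; have [v hv] := hg _ e4.
exists (kscale a u ++ v); rewrite kcombP.
have -> : a *: f + g - (a *: kcomb u + kcomb v) =
    a *: (f - kcomb u) + (g - kcomb v).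
  by rewrite scalerBr opprD addrACA.
apply: kbounded_le (kboundedD (kboundedZ a hu) hv).
rewrite -/N; have : N * (e / (4 * (N + 1))) <= e / 4.
  rewrite mulrA ler_pdivrMr; last by lra.
  by nra.
by lra.
Qed.

HB.instance Definition _ := GRing.isSubmodClosed.Build C (D -> C^o) kspace kspace_submod.

Record kspace_type := Kspace { kfun :> D -> C^o; _ : kfun \in kspace }.
HB.instance Definition _ := [isSub for kfun].
HB.instance Definition _ := [Choice of kspace_type by <:].
HB.instance Definition _ := [SubChoice_isSubLmodule of kspace_type by <:].

(** * Extension of the inner product by continuity *)

Implicit Types w : nat -> seq (C * D).

Definition ktends w f :=
  forall e, 0 < e -> exists N, forall n, (N <= n)%N -> kbounded (f - kcomb (w n)) e.

Lemma ktends_exists f : f \in kspace -> exists w, ktends w f.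
Proof.
move=> /kspaceP hf.
have /choice[w hw] (n : nat) : exists u, kbounded (f - kcomb u) n.+1%:R^-1.
  by apply: hf; rewrite invr_gt0.
exists w => e /inv_nat_small[N hN]; exists N => n /hN le.
exact: kbounded_le le (hw n).
Qed.

Lemma ktends_comb u : ktends (fun=> u) (kcomb u).
Proof.
move=> e e0; exists 0%N => n _ v; rewrite pairingB subrr normr0 expr0n.
by rewrite mulr_ge0 ?kform_ge0 // ler0c ltW.
Qed.

Lemma kspace_bounded f : f \in kspace -> exists2 M, 0 <= M & kbounded f M.
Proof.
move=> /kspaceP/(_ 1 ltr01)[u hu]; have := kboundedD hu (kbounded_comb u).
rewrite subrK; set M := 2 * 1 + _; exists M => //.
by rewrite /M; have := Re_ge0 (kform_ge0 u); lra.
Qed.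

(** Sequences with a common limit are eventually close for [kform], and [f] is bounded. With
    [w = w'] this is the Cauchy property; in general it shows that the limit does not depend on the
    sequence. *)
Lemma pairing_diff f g w w' :
  f \in kspace -> ktends w g -> ktends w' g ->
  forall e, 0 < e -> exists N, forall m n, (N <= m)%N -> (N <= n)%N ->
    `|pairing f (w m) - pairing f (w' n)| <= e%:C.
Proof.
move=> /kspace_bounded[M M0 fM] hw hw' e e0.
(* Two combinations within [d] of [g] differ by at most [4 * d], and [M * (4 * d) <= e ^+ 2]. *)
set d := e ^+ 2 / (4 * (M + 1)).
have e20 : 0 < e ^+ 2 by rewrite exprn_gt0.
have d0 : 0 < d by apply: divr_gt0 => //; lra.
have [N hN] := hw _ d0; have [N' hN'] := hw' _ d0.
exists (maxn N N') => m n; rewrite !geq_max => /andP[m1 _] /andP[_ n1].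
rewrite -(sqr_norm_le _ (ltW e0)).
set z := kscale (-1) (w' n) ++ w m.
have -> : pairing f (w m) - pairing f (w' n) = pairing f z.
  by rewrite pairing_cat pairing_scale rmorphN1 mulN1r addrC.
apply: le_trans (fM z) _.
have qz : kform z z <= (4 * d)%:C.
  apply: kbounded_comb_le; last by lra.
  rewrite kcombB.
  have -> : kcomb (w m) - kcomb (w' n) = (g - kcomb (w' n)) + - (g - kcomb (w m)).
    by rewrite opprB [RHS]addrC addrA subrK.
  by apply: kbounded_le (kboundedD (hN' _ n1) (kboundedN (hN _ m1))); lra.
apply: le_trans (ler_wpM2l _ qz) _; first by rewrite ler0c.
rewrite -rmorphM lecR.
have -> : M * (4 * d) = M / (M + 1) * e ^+ 2.
  by rewrite /d; field; rewrite gt_eqF //; lra.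
rewrite -[leRHS]mul1r; apply: ler_wpM2r; first exact: ltW.
by rewrite ler_pdivrMr; lra.
Qed.

Lemma pairing_limit f g : f \in kspace -> g \in kspace ->
  exists l, forall w, ktends w g -> limC (fun n => pairing f (w n)) l.
Proof.
move=> hf hg; have [w hw] := ktends_exists hg.
have [l hl] := cauchy_limC (pairing_diff hf hw hw).
exists l => w' hw'; apply: limC_squeeze hl _ => e e0.
have [N hN] := pairing_diff hf hw' hw e0; exists N => n Nn.
by rewrite subr0; exact: hN.
Qed.

(** On [kspace] the set is inhabited by [pairing_limit], so the default 0 does not occur there. *)
Definition kip f g : C :=
  xget 0 [set l | forall w, ktends w g -> limC (fun n => pairing f (w n)) l]%classic.

Lemma kipP f g w : f \in kspace -> g \in kspace -> ktends w g ->
  limC (fun n => pairing f (w n)) (kip f g).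
Proof.
move=> hf hg; rewrite /kip; have [l hl] := pairing_limit hf hg.
case: xgetP => [l' -> h|/(_ l)]; [exact: h|by case].
Qed.

Lemma kip_comb f u : f \in kspace -> kip f (kcomb u) = pairing f u.
Proof.
move=> hf; apply: limC_unique (kipP hf (kcomb_in u) (@ktends_comb u)) _.
exact: limC_cst.
Qed.

Lemma kip_linl a f g h : f \in kspace -> g \in kspace -> h \in kspace ->
  kip (a *: f + g) h = a * kip f h + kip g h.
Proof.
move=> hf hg hh; have [w hw] := ktends_exists hh.
have hfg : a *: f + g \in kspace by apply: rpredD => //; apply: rpredZ.
apply: limC_unique (kipP hfg hh hw) _.
apply: eq_limC (limCD (limCZ a (kipP hf hh hw)) (kipP hg hh hw)) => n.
by rewrite pairingP.
Qed.

Lemma ktends_form_bounded w f : ktends w f -> f \in kspace ->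
  exists2 M, 0 < M & exists N, forall n, (N <= n)%N -> kform (w n) (w n) <= M%:C.
Proof.
move=> hw /kspace_bounded[M M0 fM]; exists (2 * M + 2); first by lra.
have [N hN] := hw _ ltr01; exists N => n /hN h.
apply: kbounded_comb_le; last by lra.
have -> : kcomb (w n) = f + - (f - kcomb (w n)) by rewrite opprB addrCA subrr addr0.
by apply: kbounded_le (kboundedD fM (kboundedN h)); lra.
Qed.

(** The error [pairing (f - kcomb (u n)) (w n)] vanishes because the seminorms of [w n] stay
    bounded. Symmetry and positivity of [kform] thus pass to [kip]. *)
Lemma kip_form_limit f g (u w : nat -> seq (C * D)) : f \in kspace -> g \in kspace ->
  ktends u f -> ktends w g -> limC (fun n => kform (u n) (w n)) (kip f g).
Proof.
move=> hf hg hu hw; apply: limC_squeeze (kipP hf hg hw) _ => e e0.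
have [M M0 [N hN]] := ktends_form_bounded hw hg.
have d0 : 0 < e ^+ 2 / M by rewrite divr_gt0 // exprn_gt0.
have [N' hN'] := hu _ d0; exists (maxn N N') => n; rewrite geq_max => /andP[h1 h2].
rewrite subr0 -(sqr_norm_le _ (ltW e0)) distrC -pairingB; apply: le_trans (hN' _ h2 _) _.
apply: le_trans (ler_wpM2l _ (hN _ h1)) _; first by rewrite ler0c ltW.
by rewrite -rmorphM lecR divfK // gt_eqF.
Qed.

Lemma kip_conj f g : f \in kspace -> g \in kspace -> kip g f = (kip f g)^*.
Proof.
move=> hf hg; have [u hu] := ktends_exists hf; have [w hw] := ktends_exists hg.
apply: limC_unique (kip_form_limit hg hf hw hu) _.
apply: eq_limC (limC_conj (kip_form_limit hf hg hu hw)) => n.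
by rewrite -kform_conj.
Qed.

Lemma kip_ge0 f : f \in kspace -> 0 <= kip f f.
Proof.
move=> hf; have [u hu] := ktends_exists hf.
apply: limC_ge0 (kip_form_limit hf hf hu hu) _.
by exists 0%N => n _; exact: kform_ge0.
Qed.

(** The factor 4 is the loss in [kboundedD], harmless for convergence. *)
Lemma kip_le_bound f e : f \in kspace -> 0 < e -> kbounded f e -> kip f f <= (4 * e)%:C.
Proof.
move=> hf e0 he; have [u hu] := ktends_exists hf.
apply: limC_le (kip_form_limit hf hf hu hu) _.
have [N hN] := hu _ e0; exists N => n /hN h.
apply: kbounded_comb_le; last by lra.
have -> : kcomb (u n) = f + - (f - kcomb (u n)) by rewrite opprB addrCA subrr addr0.
by apply: kbounded_le (kboundedD he (kboundedN h)); lra.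
Qed.

Definition ksip (x y : kspace_type) : C := kip (kfun x) (kfun y).

Lemma kfun_in (x : kspace_type) : kfun x \in kspace. Proof. by case: x. Qed.

Lemma ksip_linl a x y z : ksip (a *: x + y) z = a * ksip x z + ksip y z.
Proof. by apply: kip_linl; exact: kfun_in. Qed.

Lemma ksip_conj x y : ksip y x = conjc (ksip x y).
Proof. by apply: kip_conj; exact: kfun_in. Qed.

Lemma ksip_ge0 x : 0 <= ksip x x.
Proof. exact: kip_ge0 (kfun_in x). Qed.

Definition kvec u : kspace_type := Kspace (kcomb_in u).

Lemma ksip_vec x u : ksip x (kvec u) = pairing x u.
Proof. exact: kip_comb (kfun_in x). Qed.

Lemma ksip_bounded x e : ksip x x <= e%:C -> kbounded x e.
Proof.
move=> h u; rewrite -ksip_vec.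
apply: le_trans (cauchy_schwarz_form ksip_linl ksip_conj ksip_ge0 _ _) _.
rewrite {2}/ksip /= kip_comb ?kcomb_in // -/(kform u u).
by rewrite ler_wpM2r ?kform_ge0.
Qed.

Lemma pairing_point f d : pairing f [:: (1, d)] = f d.
Proof. by rewrite /pairing big_seq1 /= rmorph1 mul1r. Qed.

Lemma ksip_eq0 x : ksip x x = 0 -> x = 0.
Proof.
move=> h; apply/val_inj/funext => d /=; apply/eqP.
rewrite -[_ == _]/(kfun x d == 0) -pairing_point -normr_eq0 -sqrf_eq0; apply/eqP/le_anti.
have : ksip x x <= (0 : R)%:C by rewrite h.
by move=> /ksip_bounded/(_ [:: (1, d)]); rewrite mul0r => ->; rewrite exprn_ge0.
Qed.

(** Evaluations are bounded, so a Cauchy sequence converges pointwise; the dual norm estimates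
    survive in this limit, which puts it in [kspace] and gives convergence in norm. *)
Lemma ksip_complete (u : nat -> kspace_type) :
  (forall e, 0 < e -> exists N, forall m n, (N <= m)%N -> (N <= n)%N ->
    Num.sqrt (complex.Re (ksip (u m - u n) (u m - u n))) < e) ->
  exists l, forall e, 0 < e -> exists N, forall n, (N <= n)%N ->
    Num.sqrt (complex.Re (ksip (u n - l) (u n - l))) < e.
Proof.
move=> cu.
have cu' e : 0 < e -> exists N, forall m n, (N <= m)%N -> (N <= n)%N ->
    kbounded (kfun (u m) - kfun (u n)) e.
  move=> e0; have s0 : 0 < Num.sqrt e by rewrite sqrtr_gt0.
  have [N hN] := cu _ s0; exists N => m n /hN h /h{h}.
  rewrite sqrt_Re_lt ?ksip_ge0 // sqr_sqrtr; last exact: ltW.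
  by move=> /ltW/ksip_bounded.
have /choice[f hf] (d : D) : exists z, limC (fun n => kfun (u n) d) z.
  (* Evaluation at [d] has squared norm at most [k d d]; adding 1 allows division. *)
  apply: cauchy_limC => e e0; set s := complex.Re (k d d) + 1.
  have kd : 0 <= k d d.
    have := kform_ge0 [:: (1, d)].
    by rewrite /kform pairing_point /kcomb big_seq1 mul1r.
  have s0 : 0 < s by rewrite ltr_wpDl ?Re_ge0.
  have d0 : 0 < e ^+ 2 / s by rewrite divr_gt0 // exprn_gt0.
  have [N hN] := cu' _ d0; exists N => m n hm hn.
  rewrite -(sqr_norm_le _ (ltW e0)); have := hN m n hm hn [:: (1, d)].
  rewrite pairingB !pairing_point /kform pairing_point /kcomb big_seq1 mul1r /=.
  move=> /le_trans; apply; rewrite (ge0_complexE kd) -rmorphM lecR.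
  by rewrite mulrAC ler_pdivrMr // ler_pM2l ?exprn_gt0 // /s lerDl.
have pf v : limC (fun n => pairing (u n) v) (pairing (f : D -> C^o) v).
  elim: v => [|p v IH].
    rewrite [pairing _ [::]]/pairing big_nil.
    by apply: eq_limC (limC_cst 0) => n; rewrite /pairing big_nil.
  rewrite [pairing _ (p :: v)]/pairing big_cons.
  by apply: eq_limC (limCD (limCZ (p.1)^* (hf p.2)) IH) => n; rewrite /pairing big_cons.
(* Let [m] tend to infinity in the Cauchy bound, for each fixed [v]. *)
have bf e : 0 < e -> exists N, forall n, (N <= n)%N -> kbounded (kfun (u n) - f) e.
  move=> e0; have [N hN] := cu' _ e0; exists N => n hn v; rewrite pairingB.
  apply: (@limC_sqr_norm_le _ (fun m => pairing (u n) v + -1 * pairing (u m) v)).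
  - rewrite -(mulN1r (pairing f v)); apply: (limCD (u := fun=> pairing (u n) v)).
      exact: limC_cst.
    exact: limCZ.
  - by rewrite mulr_ge0 ?kform_ge0 // ler0c ltW.
  - by exists N => m hm; rewrite mulN1r -pairingB; exact: hN.
have fin : (f : D -> C^o) \in kspace.
  apply/kspaceP => e e0; have e4 : 0 < e / 4 by lra.
  have [N /(_ _ (leqnn _)) hN] := bf _ e4.
  have /kspaceP/(_ _ e4)[v hv] := kfun_in (u N); exists v.
  have -> : (f : D -> C^o) - kcomb v = - (kfun (u N) - f) + (kfun (u N) - kcomb v).
    by rewrite opprB addrA subrK.
  by apply: kbounded_le (kboundedD (kboundedN hN) hv); lra.
(* The factor 4 of [kip_le_bound] leaves [e ^+ 2 / 2], strictly below [e ^+ 2]. *)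
exists (Kspace fin) => e e0; have e20 : 0 < e ^+ 2 / 8 by rewrite divr_gt0 ?exprn_gt0.
have [N hN] := bf _ e20; exists N => n /hN h.
rewrite sqrt_Re_lt ?ksip_ge0 //; apply: le_lt_trans (kip_le_bound _ e20 h) _.
  exact: (kfun_in (u n - Kspace fin)).
by rewrite ltcR; lra.
Qed.

Definition khilbert : hilbert R :=
  @Hilbert R kspace_type ksip ksip_linl ksip_conj ksip_ge0 ksip_eq0 ksip_complete.

(** * Unitaries induced by symmetries of the kernel *)

Section Transport.
Variables (s s' : D -> D).
Hypotheses (sK : cancel s s') (s'K : cancel s' s).
Hypothesis ks : forall x y, k (s x) (s y) = k x y.

Let push (t : D -> D) u := [seq (p.1, t p.2) | p <- u].

Let pairing_push (t : D -> D) f u : pairing (f \o t : D -> C^o) u = pairing f (push t u).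
Proof. by rewrite /pairing /push big_map. Qed.

Let kcomb_push u : kcomb (push s u) = kcomb u \o s'.
Proof.
apply/funext => d; rewrite /kcomb /push big_map; apply: eq_bigr => p _ /=.
by rewrite -{1}[d]s'K ks.
Qed.

Let kbounded_comp f e : kbounded f e -> kbounded (f \o s' : D -> C^o) e.
Proof.
move=> h u; rewrite pairing_push; apply: le_trans (h _) _.
suff -> : kform (push s' u) (push s' u) = kform u u by [].
rewrite -[in RHS](_ : push s (push s' u) = u).
  rewrite /kform kcomb_push pairing_push.
  congr pairing; rewrite /push -!map_comp; apply: eq_map => p /=.
  by rewrite s'K.
by rewrite /push -map_comp -[RHS]map_id; apply: eq_map => -[c d] /=; rewrite s'K.
Qed.

Let ktends_comp f w : ktends w f ->
  ktends (fun n => push s (w n)) (f \o s' : D -> C^o).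
Proof.
move=> h e /h[N hN]; exists N => n /hN/kbounded_comp; rewrite kcomb_push.
by [].
Qed.

Let comp_in f : f \in kspace -> (f \o s' : D -> C^o) \in kspace.
Proof.
move=> /kspaceP h; apply/kspaceP => e /h[u /kbounded_comp hu].
by exists (push s u); rewrite kcomb_push.
Qed.

(** Precomposition with the inverse: as [k d (s' x) = k (s d) x], the kernel function of [d] goes to
    that of [s d]. *)
Definition ktransport (x : kspace_type) : kspace_type := Kspace (comp_in (kfun_in x)).

Lemma ktransport_isometry : @isometry_op R khilbert khilbert ktransport.
Proof.
split; first by move=> a x y; apply/val_inj.
move=> x y; have [w hw] := ktends_exists (kfun_in y).
apply: limC_unique (kipP (comp_in (kfun_in x)) (comp_in (kfun_in y)) (ktends_comp hw)) _.
apply: eq_limC (kipP (kfun_in x) (kfun_in y) hw) => n.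
rewrite pairing_push /push -map_comp; congr pairing.
by rewrite -[LHS]map_id; apply: eq_map => -[c d] /=; rewrite sK.
Qed.

Lemma ktransport_vec d : ktransport (kvec [:: (1, d)]) = kvec [:: (1, s d)].
Proof. by apply/val_inj; rewrite /= -kcomb_push. Qed.

End Transport.

Lemma ktransport_unitary s s' (sK : cancel s s') (s'K : cancel s' s)
    (ks : forall x y, k (s x) (s y) = k x y) :
  @unitary R khilbert (ktransport s'K ks).
Proof.
split; first exact: ktransport_isometry.
have ks' x y : k (s' x) (s' y) = k x y by rewrite -ks !s'K.
(* The preimage is the precomposition of [y] with [s]. *)
move=> y; exists (ktransport sK ks' y); apply/val_inj/funext => d /=.
by rewrite s'K.
Qed.

End KernelSpace.

(** Take for [phi d] the kernel function of [d], so that pairing with [phi d] is evaluation at [d].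
    Totality is stated as separation of vectors, the form in which identities are checked later. *)
Theorem kolmogorov_decomposition (R : realType) (D : Type) (k : D -> D -> R[i]) :
  (forall x y, k y x = (k x y)^*) ->
  (forall u : seq (R[i] * D),
    0 <= \sum_(p <- u) \sum_(r <- u) p.1 * (r.1)^* * k p.2 r.2) ->
  exists (K : hilbert R) (phi : D -> K),
    [/\ forall x y, ip (phi x) (phi y) = k x y,
        forall f g, (forall d, ip f (phi d) = ip g (phi d)) -> f = g &
        forall s s', cancel s s' -> cancel s' s ->
          (forall x y, k (s x) (s y) = k x y) ->
          exists2 U : K -> K, unitary U & forall d, U (phi d) = phi (s d)].
Proof.
move=> kC k0; exists (khilbert kC k0), (fun d => kvec k0 [:: (1, d)]).
have ev (f : khilbert kC k0) d : ip f (kvec k0 [:: (1, d)]) = kfun f d.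
  exact: etrans (ksip_vec kC k0 f _) (pairing_point _ _).
split.
- by move=> x y; rewrite ev /kcomb /= /kcomb big_seq1 mul1r.
- move=> f g h; apply/val_inj/funext => d /=.
  by rewrite -!ev h.
- move=> s s' sK s'K ks; exists (ktransport s'K ks).
    exact: ktransport_unitary.
  by move=> d; rewrite ktransport_vec.
Qed.

(** * Brehmer positivity *)

Section Brehmer.
Variables (R : realType) (H : hilbert R) (L : eqType) (T : L -> H -> H).
Local Notation C := R[i].
Hypothesis Tcontr : forall a, contraction (T a).
Implicit Types (x y z : H) (a b : L) (F : seq L).

Let Tlin a : is_linear (T a). Proof. by case: (Tcontr a). Qed.

Lemma contraction_ip a x : ip (T a x) (T a x) <= ip x x.
Proof. by rewrite -hnorm_leE; case: (Tcontr a). Qed.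

(* The form of the alternating sum of the T_G^* T_G over G \subset F. *)
Fixpoint brehmer F x y : C :=
  if F is a :: F' then brehmer F' x y - brehmer F' (T a x) (T a y) else ip x y.

Definition brehmer_positive := forall F, uniq F -> forall x, 0 <= brehmer F x x.

Lemma brehmer_linl F (c : C) x y z :
  brehmer F (c *: x + y) z = c * brehmer F x z + brehmer F y z.
Proof.
elim: F x y z => [|a F IH] x y z /=; first by rewrite ipDl ipZl.
by rewrite Tlin !IH; ring.
Qed.

Lemma brehmer_conj F x y : brehmer F y x = (brehmer F x y)^*.
Proof.
elim: F x y => [|a F IH] x y /=; first exact: ipC.
by rewrite rmorphB /= -!IH.
Qed.

Lemma brehmerZl F (c : C) x z : brehmer F (c *: x) z = c * brehmer F x z.
Proof.
have B0 : brehmer F 0 z = 0.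
  have := brehmer_linl F 1 0 0 z; rewrite scaler0 addr0 mul1r.
  by move=> /eqP; rewrite -subr_eq0 opprD addrA subrr sub0r oppr_eq0 => /eqP.
by rewrite -[c *: x]addr0 brehmer_linl B0 addr0.
Qed.

Lemma brehmerZr F (c : C) x z : brehmer F z (c *: x) = c^* * brehmer F z x.
Proof. by rewrite brehmer_conj brehmerZl rmorphM /= -brehmer_conj. Qed.

(** * Positivity under each of the three hypotheses *)

Lemma isometry_brehmer_positive : (forall a, isometry_op (T a)) -> brehmer_positive.
Proof.
move=> iso; case=> [|a F] _ x; first exact: ip_ge0.
suff -> : forall x y, brehmer (a :: F) x y = 0 by [].
elim: F a {x} => [|b F IH] a x y; first by rewrite /= (iso a).2 subrr.
by rewrite -[LHS]/(brehmer (b :: F) x y - brehmer (b :: F) (T a x) (T a y)) !IH subrr.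
Qed.

(** The infimum is itself an admissible constant: for [hnorm x > 0] the quotient
    [hnorm (T a x) / hnorm x] is a lower bound, and 1 is admissible because [T a] is a
    contraction. *)
Lemma opnorm_ip a x :
  ip (T a x) (T a x) <= (opnorm (T a) ^+ 2)%:C * ip x x.
Proof.
have n2 (y : H) : (hnorm y ^+ 2)%:C = ip y y.
  by rewrite /hnorm sqr_sqrtr ?Re_ge0 -?ge0_complexE ?ip_ge0.
have n0 (y : H) : 0 <= hnorm y by exact: sqrtr_ge0.
have ne : ([set c : R | 0 <= c /\ forall x, hnorm (T a x) <= c * hnorm x] !=set0)%classic.
  by exists 1; split=> // y; rewrite mul1r; case: (Tcontr a).
have o0 : 0 <= opnorm (T a) by apply: lb_le_inf => // c [].
suff le : hnorm (T a x) <= opnorm (T a) * hnorm x.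
  rewrite -!n2 -rmorphM lecR -exprMn.
  by rewrite ler_pXn2r ?nnegrE ?mulr_ge0.
have [x0|x0] := leP (hnorm x) 0.
  have x00 : hnorm x = 0 by apply: le_anti; rewrite x0 n0.
  by rewrite x00 mulr0 -x00; case: (Tcontr a).
rewrite -ler_pdivrMr //; apply: lb_le_inf => //.
by move=> c [_ /(_ x)]; rewrite ler_pdivrMr.
Qed.

(** Passing to [a :: F] subtracts [beta_F(T_a x, T_a x)], at most [|T_a x|^2] by the upper bound;
    the row condition makes the resulting lower bound nonnegative. *)
Lemma row_contraction_brehmer_positive :
  (forall F, uniq F -> \sum_(a <- F) opnorm (T a) ^+ 2 <= 1) -> brehmer_positive.
Proof.
move=> sum1; suff bnd F : uniq F -> forall x,
    ip x x - \sum_(a <- F) ip (T a x) (T a x) <= brehmer F x x /\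
    0 <= brehmer F x x <= ip x x.
  by move=> F uF x; have [_ /andP[]] := bnd F uF x.
have lo G x : uniq G -> 0 <= ip x x - \sum_(a <- G) ip (T a x) (T a x).
  move=> uG; rewrite subr_ge0.
  apply: (@le_trans _ _ ((\sum_(a <- G) opnorm (T a) ^+ 2)%:C * ip x x)).
    rewrite rmorph_sum mulr_suml; apply: ler_sum => a _; exact: opnorm_ip.
  by rewrite -[leRHS]mul1r ler_wpM2r ?ip_ge0 // -(rmorph1 (real_complex R)) lecR sum1.
elim: F => [|a F IH] uF x; first by rewrite big_nil subr0 /= lexx ip_ge0.
have /IH{}IH : uniq F by case/andP: uF.
have [h1 /andP[h2 h3]] := IH x; have [_ /andP[g2 g3]] := IH (T a x).
have le : ip x x - \sum_(b <- a :: F) ip (T b x) (T b x) <= brehmer (a :: F) x x.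
  rewrite big_cons opprD addrA addrAC /=.
  by apply: lerB.
split=> //; rewrite (le_trans (lo _ x uF) le) /=.
by apply: le_trans h3; rewrite gerBl.
Qed.

(** Log-convexity implies convexity by the arithmetic-geometric mean inequality, and a convex
    sequence with an initial increase grows at least linearly. *)
Lemma bounded_logconvex_le (u : nat -> R) (M : R) : (forall n, 0 <= u n <= M) ->
  (forall n, u n.+1 ^+ 2 <= u n * u n.+2) -> u 1%N <= u 0%N.
Proof.
move=> uM lc; rewrite leNgt; apply/negP => lt.
have cvx n : u n.+1 + u n.+1 <= u n + u n.+2.
  have /andP[a0 _] := uM n; have /andP[b0 _] := uM n.+2.
  have := lc n; have := sqr_ge0 (u n - u n.+2) => sq le.
  rewrite leNgt; apply/negP => l.
  have /andP[c0 _] := uM n.+1.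
  have : 0 < (u n.+1 + u n.+1 - (u n + u n.+2)) * (u n.+1 + u n.+1 + (u n + u n.+2)).
    by apply: mulr_gt0; lra.
  by nra.
pose d := u 1%N - u 0%N.
have grow n : d <= u n.+1 - u n.
  elim: n => [|n IH]; first by [].
  by have := cvx n; lra.
have big n : u 0%N + n%:R * d <= u n.
  elim: n => [|n IH]; first by rewrite mul0r addr0.
  by have := grow n; rewrite -natr1 mulrDl; lra.
have d0 : 0 < d by rewrite subr_gt0.
(* At this index [n * d > M], so the linear lower bound exceeds [M]. *)
have := big (Num.Def.truncn (M / d)).+1; have /andP[_ ] := uM (Num.Def.truncn (M / d)).+1.
have := truncnS_gt (M / d); rewrite ltr_pdivrMr //.
have /andP[] := uM 0%N; lra.
Qed.

Lemma adjoint_contraction a (S : H -> H) y : is_adjoint (T a) S -> ip (S y) (S y) <= ip y y.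
Proof.
move=> adj; have [->|n0] := eqVneq (ip (S y) (S y)) 0; first exact: ip_ge0.
have p0 : 0 < ip (S y) (S y) by rewrite lt_def n0 ip_ge0.
rewrite -(ler_pM2l p0).
have -> : ip (S y) (S y) * ip (S y) (S y) = `|ip (T a (S y)) y| ^+ 2.
  by rewrite adj ger0_norm ?ip_ge0 // expr2.
apply: le_trans (cauchy_schwarz _ _) _.
by rewrite ler_wpM2r ?ip_ge0 // contraction_ip.
Qed.

(* The values beta(x_n, x_n) of beta = brehmer F along x_0 = x, x_1 = T x_0,
   x_2 = T^* x_1, x_3 = T x_2, ... are log-convex and bounded, hence decrease. *)
Lemma brehmer_symmetrizable_le F a (S : H -> H) x : is_adjoint (T a) S ->
  (forall x y, brehmer F (T a x) y = brehmer F x (S y)) ->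
  (forall x, 0 <= brehmer F x x <= ip x x) ->
  brehmer F (T a x) (T a x) <= brehmer F x x.
Proof.
move=> adj sym bnd.
have B0 z : 0 <= brehmer F z z by case/andP: (bnd z).
pose step n := if odd n then S else T a.
pose xs := fix xs n := if n is m.+1 then step m (xs m) else x.
have xsE n : xs n.+1 = step n (xs n) by [].
have ip_xs n : ip (xs n) (xs n) <= ip x x.
  elim: n => [|n IH] //; apply: le_trans IH; rewrite xsE /step.
  by case: odd; [exact: adjoint_contraction adj|exact: contraction_ip].
pose v n := complex.Re (brehmer F (xs n) (xs n)).
have vE n : brehmer F (xs n) (xs n) = (v n)%:C by rewrite -ge0_complexE.
suff : v 1%N <= v 0%N by rewrite -lecR -!vE.
apply: (@bounded_logconvex_le _ (complex.Re (ip x x))) => n.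
  rewrite -!lecR -vE -ge0_complexE ?ip_ge0 // B0 /=.
  by apply: le_trans (ip_xs n); case/andP: (bnd (xs n)).
rewrite -lecR rmorphXn rmorphM /= -!vE.
(* For either parity, [step n] moves to the other argument as its adjoint [step n.+1].
   Cauchy-Schwarz for the form then gives log-convexity. *)
have E : brehmer F (xs n.+1) (xs n.+1) = brehmer F (xs n) (xs n.+2).
  rewrite !xsE /step /=; case: (odd n) => /=; last exact: sym.
  by rewrite brehmer_conj -sym -brehmer_conj.
rewrite -[leLHS]ger0_norm ?exprn_ge0 // normrX E.
exact: cauchy_schwarz_form (brehmer_linl F) (brehmer_conj F) B0 _ _.
Qed.

Variable q : L -> L -> C.
Hypothesis Tq : q_commuting q T.

Lemma doubly_commuting_brehmer_positive :
  (forall a b, a <> b -> forall S : H -> H, is_adjoint (T b) S ->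
     forall x, T a (S x) = (q a b)^* *: S (T a x)) -> brehmer_positive.
Proof.
move=> dc; suff bnd F : uniq F -> forall x, 0 <= brehmer F x x <= ip x x.
  by move=> F /bnd h x; case/andP: (h x).
elim: F => [|a F IH] /=; first by move=> _ x; rewrite ip_ge0 lexx.
move=> /andP[aF /IH{}IH] x.
have [S adj] := adjoint_exists (Tlin a) (contraction_ip a).
(* Moving [T b] past [T a] on the left and past [S] on the right produces the same factor [q b a],
   the latter after conjugation. *)
have sym y z : brehmer F (T a y) z = brehmer F y (S z).
  elim: F aF y z {IH} => [|b F IHF] /=; first by move=> _; exact: adj.
  rewrite inE negb_or => /andP[/eqP ab aF] y z.
  have ba : b <> a by move=> /esym.
  rewrite IHF // (Tq ba) brehmerZl IHF //; congr (_ - _).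
  by rewrite (dc _ _ ba _ adj) brehmerZr conjCK.
have /andP[h1 h2] := IH x; have /andP[g1 g2] := IH (T a x).
rewrite subr_ge0 (brehmer_symmetrizable_le _ adj) //=.
by apply: le_trans h2; rewrite gerBl.
Qed.

End Brehmer.

Lemma prod_uniq_support (R : comNzRingType) (L : eqType) (S S' : seq L) (F : L -> R) :
  uniq S -> uniq S' -> (forall a, a \notin S -> F a = 1) ->
  (forall a, a \notin S' -> F a = 1) -> \prod_(a <- S) F a = \prod_(a <- S') F a.
Proof.
move=> uS uS' h h'.
rewrite -(big_rmcond_in (r := S) (mem S')); last by move=> a _; exact: h'.
rewrite -(big_rmcond_in (r := S') (mem S)); last by move=> a _; exact: h.
rewrite -[LHS]big_filter -[RHS]big_filter; apply: perm_big; apply: uniq_perm; rewrite ?filter_uniq //.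
by move=> a; rewrite !mem_filter andbC.
Qed.

(** * The twisted kernel and the dilation *)

Section TwistedWords.
Variables (R : realType) (H : hilbert R) (L : eqType) (T : L -> H -> H).
Variables (q chi : L -> L -> R[i]).
Local Notation C := R[i].
Hypothesis Tcontr : forall a, contraction (T a).
Hypothesis Tq : q_commuting q T.
Hypothesis chi_norm : forall a b, `|chi a b| = 1.
Hypothesis chi_diag : forall a, chi a a = 1.
Hypothesis chi_q : forall a b, a <> b -> chi a b = q a b * chi b a.
Implicit Types (x y : H) (a b : L) (w S : seq L) (m n : L -> int).

Let Tlin a : is_linear (T a). Proof. by case: (Tcontr a). Qed.

Lemma unimodular_unit (z : C) : `|z| = 1 -> z \is a GRing.unit.
Proof. by move=> z1; rewrite unitfE -normr_eq0 z1 oner_neq0. Qed.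

Lemma unimodular_conj (z : C) : `|z| = 1 -> z * z^* = 1.
Proof. by move=> z1; rewrite -normCK z1 expr1n. Qed.

Lemma unimodular_conjV (z : C) : `|z| = 1 -> z^* = z^-1.
Proof.
move=> z1; apply: (mulrI (unimodular_unit z1)).
by rewrite unimodular_conj // divrr // unimodular_unit.
Qed.

(* The product of the T_a along w, with the phase that makes it independent of the
   order of w. *)
Fixpoint wop w x : H :=
  if w is a :: w' then (\prod_(b <- w') chi a b)^* *: T a (wop w' x) else x.

Lemma prod_chi_norm a w : `|\prod_(b <- w) chi a b| = 1.
Proof. by rewrite normr_prod big1. Qed.

Lemma wop_apply a w x : T a (wop w x) = (\prod_(b <- w) chi a b) *: wop (a :: w) x.
Proof. by rewrite /= scalerA unimodular_conj ?scale1r ?prod_chi_norm. Qed.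

Lemma wop_linear w : is_linear (wop w).
Proof.
elim: w => [|a w IH] c x y //=.
by rewrite IH Tlin scalerDr !scalerA mulrC.
Qed.

(** The factor [q a b] from exchanging [T a] and [T b] turns the conjugate of [chi a b] into that of
    [chi b a]. *)
Lemma wop_swap a b w x : wop (a :: b :: w) x = wop (b :: a :: w) x.
Proof.
have [-> //|/eqP ab] := eqVneq a b.
rewrite /= !(is_linearZ _ _ (Tlin _)) !scalerA (Tq ab) !big_cons scalerA; congr (_ *: _).
rewrite !rmorphM /= (chi_q ab) rmorphM /=.
have q1 : (q a b)^* * q a b = 1.
  rewrite mulrC unimodular_conj //.
  by have := chi_norm a b; rewrite (chi_q ab) normrM chi_norm mulr1.
have -> (u v s t z : C) : u * v * s * t * z = (u * z) * (v * s * t) by ring.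
by rewrite q1 mul1r; ring.
Qed.

Lemma wop_perm w w' x : perm_eq w w' -> wop w x = wop w' x.
Proof.
have perm_mid a w1 w2 : perm_eq (w1 ++ a :: w2) (a :: w1 ++ w2).
  by rewrite (perm_catCA w1 [:: a] w2).
have mid a w1 w2 : wop (w1 ++ a :: w2) x = wop (a :: w1 ++ w2) x.
  elim: w1 => [//|b w1 IH]; rewrite [RHS]wop_swap [LHS]/= IH [RHS]/=.
  by rewrite (perm_big _ (perm_mid a w1 w2)).
elim: w w' => [|a w IH] w' pw; first by have /perm_nilP -> : perm_eq w' [::] by rewrite perm_sym.
have aw' : a \in w' by rewrite -(perm_mem pw) mem_head.
case/splitPr: aw' pw => w1 w2 pw; rewrite mid /=.
have pw' : perm_eq w (w1 ++ w2) by rewrite -(perm_cons a) -(permPr (perm_mid a w1 w2)).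
by rewrite (IH _ pw') (perm_big _ pw').
Qed.

(* Only used for m >= 0 on S: a negative m a contributes |m a| copies of a. *)
Definition word S m := flatten [seq nseq `|m a|%N a | a <- S].

Lemma count_word S m b : uniq S ->
  count_mem b (word S m) = if b \in S then `|m b|%N else 0%N.
Proof.
rewrite /word; elim: S => [//|a S IH] /= /andP[aS /IH{}IH].
rewrite count_cat IH count_nseq inE /= [b == a]eq_sym.
by case: eqVneq aS => [->|_ _] /=; [move=> /negPf ->; rewrite mul1n addn0|rewrite mul0n].
Qed.

Definition wpow S m := wop (word S m).

(** The bicharacter [c], computed over a list; by [cocycle_support] any list covering both supports
    gives the same value. *)
Definition cocycle S m n : C := \prod_(a <- S) \prod_(b <- S) chi a b ^ (m a * n b).

Definition delta a : L -> int := fun b => (b == a)%:R.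

Definition supported S m := forall a, a \notin S -> m a = 0.

Lemma wpow_support S S' m : uniq S -> uniq S' -> supported S m -> supported S' m ->
  wpow S m =1 wpow S' m.
Proof.
move=> uS uS' h h' x; apply: wop_perm; apply/allP => b _ /=.
rewrite !count_word //; apply/eqP.
by case: ifPn => [_|/h ->]; case: ifPn => [_|h0] //; rewrite (h' _ h0).
Qed.

Lemma wpow0 S x : wpow S 0 x = x.
Proof. by rewrite /wpow /word; elim: S. Qed.

Lemma exprz_norm (z : C) (i : int) : `|z| = 1 -> `|z ^ i| = 1.
Proof.
move=> z1; case: i => i; first by rewrite -exprnP normrX z1 expr1n.
by rewrite NegzE -exprnN normrV ?unitrX ?unimodular_unit // normrX z1 expr1n invr1.
Qed.

Lemma cocycle_norm S m n : `|cocycle S m n| = 1.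
Proof.
rewrite normr_prod big1 // => a _; rewrite normr_prod big1 // => b _.
exact: exprz_norm.
Qed.

Lemma cocycleDl S m m' n : cocycle S (m + m') n = cocycle S m n * cocycle S m' n.
Proof.
rewrite -big_split; apply: eq_bigr => a _; rewrite -big_split; apply: eq_bigr => b _.
by rewrite -[(m + m') a]/(m a + m' a) mulrDl exprzDr ?unimodular_unit.
Qed.

Lemma cocycleDr S m m' n : cocycle S n (m + m') = cocycle S n m * cocycle S n m'.
Proof.
rewrite -big_split; apply: eq_bigr => a _; rewrite -big_split; apply: eq_bigr => b _.
by rewrite -[(m + m') b]/(m b + m' b) mulrDr exprzDr ?unimodular_unit.
Qed.

Lemma cocycleNl S m n : cocycle S (- m) n = (cocycle S m n)^*.
Proof.
rewrite rmorph_prod; apply: eq_bigr => a _; rewrite rmorph_prod; apply: eq_bigr => b _.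
rewrite -[(- m) a]/(- m a) mulNr -invr_expz /= unimodular_conjV //.
exact: exprz_norm.
Qed.

Lemma cocycleNr S m n : cocycle S n (- m) = (cocycle S n m)^*.
Proof.
rewrite rmorph_prod; apply: eq_bigr => a _; rewrite rmorph_prod; apply: eq_bigr => b _.
rewrite -[(- m) b]/(- m b) mulrN -invr_expz /= unimodular_conjV //.
exact: exprz_norm.
Qed.

Lemma cocycle_support S S' m n : uniq S -> uniq S' -> supported S m -> supported S' m ->
  supported S n -> supported S' n -> cocycle S m n = cocycle S' m n.
Proof.
move=> uS uS' hm hm' hn hn'.
have E a : \prod_(b <- S) chi a b ^ (m a * n b) = \prod_(b <- S') chi a b ^ (m a * n b).
  by apply: prod_uniq_support => // b; [move=> /hn ->|move=> /hn' ->]; rewrite mulr0.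
rewrite /cocycle; under eq_bigr => a _ do rewrite E.
apply: prod_uniq_support => // a; [move=> /hm ->|move=> /hm' ->];
  by apply: big1 => b _; rewrite mul0r.
Qed.

Lemma cocycle_delta S a n : uniq S -> a \in S ->
  cocycle S (delta a) n = \prod_(b <- S) chi a b ^ n b.
Proof.
move=> uS aS; rewrite /cocycle (bigD1_seq a) //= [X in _ * X]big1 ?mulr1.
  by apply: eq_bigr => b _; rewrite /delta eqxx mul1r.
by move=> c ca; apply: big1 => b _; rewrite /delta (negPf ca) mul0r.
Qed.

(** Nonnegativity makes the word contain exactly [m b] copies of [b], so prefixing [a] adds one to
    [m a] and collects the phase [c(e_a, m)]. *)
Lemma wpow_apply S a m x : uniq S -> a \in S -> (forall b, b \in S -> 0 <= m b) ->
  T a (wpow S m x) = cocycle S (delta a) m *: wpow S (m + delta a) x.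
Proof.
move=> uS aS m0; rewrite /wpow wop_apply; congr (_ *: _).
  rewrite cocycle_delta // /word big_flatten big_map; apply: eq_big_seq => b bS.
  rewrite big_nseq.
  have := m0 b bS; case: (m b) => // k _.
  by rewrite /= -exprnP; elim: k => [//|k IH]; rewrite iterS IH exprS.
apply: wop_perm; apply/allP => b _ /=; rewrite !count_word //; apply/eqP.
case: ifPn => bS; last by rewrite (negPf (memPn bS _ aS)).
rewrite -[(m + delta a) b]/(m b + (b == a)%:R) [a == b]eq_sym.
have := m0 b bS; case: (m b) => // k _.
by case: (b == a); [rewrite add1n -(PoszD k 1) addn1|rewrite addr0].
Qed.

(* For F = [::] and p = min(m,n) this is the kernel; the other cases arise when p is
   lowered coordinate by coordinate. *)
Definition kap S F (p : L -> int) m n x y : C :=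
  (cocycle S p m)^* * cocycle S p n *
  brehmer T F (wpow S (m - p) x) (wpow S (n - p) y).

Definition le_on S (p m : L -> int) := forall b, b \in S -> p b <= m b.

(** The recursion of [brehmer]: applying [T a] to [T^(m-p) x] and [T^(n-p) y] lowers [p] at [a], and
    the phases turn into the prefactors of [p - delta a]. *)
Lemma kap_step S F a p m n x y : uniq S -> a \in S -> le_on S p m -> le_on S p n ->
  kap S F p m n x y = kap S F (p - delta a) m n x y + kap S (a :: F) p m n x y.
Proof.
move=> uS aS pm pn; rewrite /kap /= mulrBr addrCA; apply/eqP.
rewrite addrC -subr_eq subrr eq_sym subr_eq0; apply/eqP.
have ap (r : L -> int) z : le_on S p r -> T a (wpow S (r - p) z) =
    (cocycle S (delta a) r * (cocycle S (delta a) p)^*) *: wpow S (r - (p - delta a)) z.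
  move=> pr; rewrite wpow_apply //; last first.
    by move=> b /pr; rewrite -[(r - p) b]/(r b - p b) subr_ge0.
  by rewrite cocycleDr cocycleNr opprB addrA addrAC.
rewrite !ap // !(brehmerZl Tcontr) !(brehmerZr Tcontr) !cocycleDl !cocycleNl.
rewrite !rmorphM /= !conjCK.
have := unimodular_conj (cocycle_norm S (delta a) p).
move: (brehmer _ _ _ _) => B; set c := cocycle _ _ p => cc.
transitivity ((c * c^*) * ((cocycle S p m)^* * cocycle S (delta a) m *
  (cocycle S p n * (cocycle S (delta a) n)^*) * B)); first by rewrite cc mul1r; ring.
by ring.
Qed.

Definition upd (p : L -> int) a (v : int) : L -> int := fun b => if b == a then v else p b.

(** The step from level [lo + j + 1] down to [lo + j] leaves its Brehmer term at the upper level,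
    hence [j.+1]. *)
Lemma kap_steps S F a p m n x y (lo : int) (t : nat) : uniq S -> a \in S ->
  le_on S p m -> le_on S p n -> p a = lo + t%:Z ->
  kap S F p m n x y = kap S F (upd p a lo) m n x y +
    \sum_(j < t) kap S (a :: F) (upd p a (lo + j.+1%:Z)) m n x y.
Proof.
move=> uS aS; elim: t p => [|t IH] p pm pn pa.
  rewrite big_ord0 addr0; congr kap; apply/funext => b; rewrite /upd.
  by case: eqP => [->|//]; rewrite pa addr0.
have dE b : (p - delta a) b = p b - (b == a)%:R by [].
have dp b : (p - delta a) b <= p b by rewrite dE gerBl.
have updE v : upd (p - delta a) a v = upd p a v.
  by apply/funext => b; rewrite /upd dE; case: eqP => // _; rewrite subr0.
rewrite (kap_step _ _ _ uS aS pm pn) IH.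
- rewrite big_ord_recr /= addrA updE; congr (_ + _ + _).
    by apply: eq_bigr => j _; rewrite updE.
  congr kap; apply/funext => b; rewrite /upd.
  by case: eqP => [->|//]; rewrite pa.
- by move=> b /pm; apply: le_trans.
- by move=> b /pn; apply: le_trans.
- by rewrite dE eqxx pa -[t.+1]addn1 PoszD addrA addrK.
Qed.

Definition pmin m n : L -> int := fun b => Num.min (m b) (n b).

Lemma brehmer_sum_ge0 (I : Type) (u : seq I) F (z : I -> H) :
  brehmer_positive T -> uniq F ->
  0 <= \sum_(i <- u) \sum_(j <- u) brehmer T F (z i) (z j).
Proof.
move=> pos uF; have suml y : \sum_(i <- u) brehmer T F (z i) y =
    brehmer T F (\sum_(i <- u) z i) y.
  elim: u => [|i u IH]; last first.
    by rewrite !big_cons IH -[z i]scale1r (brehmer_linl Tcontr) mul1r scale1r.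
  rewrite !big_nil; have := brehmerZl Tcontr F 0 0 y.
  by rewrite scale0r mul0r => ->.
rewrite exchange_big; under eq_bigr => j _ do rewrite suml (brehmer_conj T).
rewrite -rmorph_sum /= suml geC0_conj; exact: pos.
Qed.

(** Induction on [G], the coordinates where [p] still depends on the pair; [l] holds the values
    already fixed, and [F] the coordinates of Brehmer terms. For empty [G] the phases split between
    the two indices, leaving a sum of [beta_F] over pairs of vectors. *)
Lemma kap_ge0 S G F (l : L -> int) (lo : int) (M : nat) (u : seq ((L -> int) * H)) :
  brehmer_positive T -> uniq S -> {subset G <= S} -> uniq (G ++ F) ->
  (forall i, i \in u -> forall b, b \in S ->
     (b \notin G -> l b <= i.1 b) /\ lo <= i.1 b <= lo + M%:Z) ->
  0 <= \sum_(i <- u) \sum_(j <- u)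
    kap S F (fun b => if b \in G then pmin i.1 j.1 b else l b) i.1 j.1 i.2 j.2.
Proof.
move=> pos uS; elim: G F l u => [|a G IH] F l u GS uGF hu.
  pose z (i : (L -> int) * H) := (cocycle S l i.1)^* *: wpow S (i.1 - l) i.2.
  have := brehmer_sum_ge0 u z pos uGF; congr (0 <= _).
  apply: eq_bigr => i _; apply: eq_bigr => j _.
  by rewrite (brehmerZl Tcontr) (brehmerZr Tcontr) conjCK mulrA.
have aS : a \in S by apply: GS; rewrite mem_head.
have /= /andP[aGF uGF'] := uGF.
have aG : a \notin G by apply: contra aGF; rewrite mem_cat => ->.
have GS' : {subset G <= S} by move=> b bG; apply: GS; rewrite inE bG orbT.
have uG : uniq (G ++ a :: F) by rewrite (uniq_catCA G [:: a] F).
pose pg (l : L -> int) (i j : (L -> int) * H) : L -> int :=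
  fun b => if b \in G then pmin i.1 j.1 b else l b.
pose above (k : nat) := [pred i : (L -> int) * H | lo + k.+1%:Z <= i.1 a].
have split i j : i \in u -> j \in u ->
    kap S F (fun b => if b \in a :: G then pmin i.1 j.1 b else l b) i.1 j.1 i.2 j.2 =
    kap S F (pg (upd l a lo) i j) i.1 j.1 i.2 j.2 +
    \sum_(k < M) (if above k i && above k j then
      kap S (a :: F) (pg (upd l a (lo + k.+1%:Z)) i j) i.1 j.1 i.2 j.2 else 0).
  move=> iu ju; set p := (fun b => _).
  have updE v : upd p a v = pg (upd l a v) i j.
    apply/funext => b; rewrite /upd /p /pg inE.
    by case: eqP => [->|//]; rewrite (negPf aG).
  have pa : p a = pmin i.1 j.1 a by rewrite /p mem_head.
  have [_ /andP[i1 i2]] := hu i iu a aS; have [_ /andP[j1 j2]] := hu j ju a aS.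
  have pmin_lo : lo <= pmin i.1 j.1 a by rewrite le_min i1.
  have [t pt] : exists t : nat, pmin i.1 j.1 a = lo + t%:Z.
    exists `|pmin i.1 j.1 a - lo|%N.
    by rewrite gez0_abs ?subr_ge0 // [RHS]addrC subrK.
  have tM : (t <= M)%N.
    by rewrite -lez_nat -(lerD2l lo) -pt ge_min i2.
  rewrite (@kap_steps S F a p i.1 j.1 i.2 j.2 lo t) ?pa // ?updE.
  - congr (_ + _); rewrite (big_ord_widen _ (fun k => kap S (a :: F)
      (upd p a (lo + k.+1%:Z)) i.1 j.1 i.2 j.2) tM) big_mkcond.
    apply: eq_bigr => k _; rewrite updE /= -le_min -/(pmin _ _ a) pt lerD2l lez_nat.
    by [].
  - move=> b bS; rewrite /p; case: ifPn => [_|/(proj1 (hu i iu b bS)) //].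
    by rewrite ge_min lexx.
  - move=> b bS; rewrite /p; case: ifPn => [_|/(proj1 (hu j ju b bS)) //].
    by rewrite ge_min lexx orbT.
under eq_big_seq => i iu do under eq_big_seq => j ju do rewrite split //.
under eq_bigr => i _ do rewrite big_split.
rewrite big_split addr_ge0 //.
  apply: IH => // i iu b bS; have [h1 h2] := hu i iu b bS; split=> // bG.
  rewrite /upd; case: eqP => [->|/eqP ba]; last by apply: h1; rewrite inE negb_or ba.
  by have [_ /andP[]] := hu i iu a aS.
under eq_bigr => i _ do rewrite exchange_big.
rewrite exchange_big; apply: sumr_ge0 => k _.
(* The minimum of two exponents reaches a level only if both do, so each level contributes a full
   double sum over a sublist. *)
set s := (Y in 0 <= Y).
have -> : s = \sum_(i <- [seq i <- u | above k i]) \sum_(j <- [seq j <- u | above k j])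
    kap S (a :: F) (pg (upd l a (lo + k.+1%:Z)) i j) i.1 j.1 i.2 j.2.
  rewrite /s big_filter [in RHS]big_mkcond; apply: eq_bigr => i _.
  case: (above k i); last by rewrite big1.
  by rewrite big_filter [in RHS]big_mkcond.
apply: IH => // i; rewrite mem_filter => /andP[ai iu] b bS.
have [h1 h2] := hu i iu b bS; split=> // bG; rewrite /upd.
by case: eqP => [->|/eqP ba] //; apply: h1; rewrite inE negb_or ba.
Qed.

(** * Finitely supported exponents and the dilation kernel *)

Record findex := Findex {
  fidx :> L -> int;
  fidx_supp : exists S, uniq S /\ supported S fidx }.

HB.instance Definition _ := gen_eqMixin findex.

Lemma findex_ext (m n : findex) : fidx m = fidx n -> m = n.
Proof.
case: m n => m hm [n hn] /= E; case: _ / E hn => hn.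
by rewrite (Prop_irrelevance hm hn).
Qed.

Definition cover (m : findex) : seq L := sval (cid (fidx_supp m)).

Lemma cover_uniq (m : findex) : uniq (cover m).
Proof. by rewrite /cover; case: cid => S []. Qed.

Lemma cover_supported (m : findex) : supported (cover m) m.
Proof. by rewrite /cover; case: cid => S []. Qed.

Lemma supported_sub S S' m : {subset S <= S'} -> supported S m -> supported S' m.
Proof. by move=> sub h a aS'; apply: h; apply: contra aS' => /sub. Qed.

Lemma supportedB S m n : supported S m -> supported S n -> supported S (m - n).
Proof. by move=> hm hn a aS; rewrite -[(m - n) a]/(m a - n a) hm ?hn. Qed.

Lemma supportedD S m n : supported S m -> supported S n -> supported S (m + n).
Proof. by move=> hm hn a aS; rewrite -[(m + n) a]/(m a + n a) hm ?hn. Qed.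

Lemma supported_pmin S m n : supported S m -> supported S n -> supported S (pmin m n).
Proof. by move=> hm hn a aS; rewrite /pmin hm ?hn. Qed.

Lemma supported_delta S a : a \in S -> supported S (delta a).
Proof. by move=> aS b bS; rewrite /delta; case: eqP bS => // ->; rewrite aS. Qed.

Implicit Types d : findex * H.

Definition dker d d' : C :=
  kap (undup (cover d.1 ++ cover d'.1)) [::] (pmin d.1 d'.1) d.1 d'.1 d.2 d'.2.

(** Frees the kernel from the chosen covers, so that several indices can be evaluated over one
    list. *)
Lemma dkerE S d d' : uniq S -> supported S d.1 -> supported S d'.1 ->
  dker d d' = kap S [::] (pmin d.1 d'.1) d.1 d'.1 d.2 d'.2.
Proof.
case: d d' => [m x] [n y] /= uS hm hn; rewrite /dker /=.
set S' := undup _; have uS' : uniq S' := undup_uniq _.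
have hm' : supported S' m.
  apply: supported_sub (@cover_supported m) => a am.
  by rewrite mem_undup mem_cat am.
have hn' : supported S' n.
  apply: supported_sub (@cover_supported n) => a an.
  by rewrite mem_undup mem_cat an orbT.
have hp := supported_pmin hm hn; have hp' := supported_pmin hm' hn'.
rewrite /kap !(cocycle_support uS' uS) //.
by rewrite !(wpow_support uS' uS) //; apply: supportedB.
Qed.

Lemma cover2 (m n : findex) (s : seq L) :
  exists S, [/\ uniq S, {subset s <= S}, supported S m & supported S n].
Proof.
exists (undup (s ++ cover m ++ cover n)); split.
- exact: undup_uniq.
- by move=> a as_; rewrite mem_undup mem_cat as_.
- apply: supported_sub (@cover_supported m) => a am.
  by rewrite mem_undup !mem_cat am orbT.
- apply: supported_sub (@cover_supported n) => a an.
  by rewrite mem_undup !mem_cat an !orbT.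
Qed.

Lemma dker_conj d d' : dker d' d = (dker d d')^*.
Proof.
have [S [uS _ hm hn]] := cover2 d.1 d'.1 [::].
rewrite !(dkerE uS) // /kap /= [in LHS]ipC !rmorphM /= conjCK.
have -> : pmin d'.1 d.1 = pmin d.1 d'.1 by apply/funext => b; rewrite /pmin minC.
by ring.
Qed.

Lemma dker_linl (m : findex) (c : C) x y d :
  dker (m, c *: x + y) d = c * dker (m, x) d + dker (m, y) d.
Proof. by rewrite /dker /kap /wpow /= wop_linear ipDl ipZl; ring. Qed.

Lemma dker_scale (m n : findex) (c e : C) x y :
  dker (m, c *: x) (n, e *: y) = c * e^* * dker (m, x) (n, y).
Proof.
have l (k : findex) (z : C) v d : dker (k, z *: v) d = z * dker (k, v) d.
  have d0 : dker (k, 0) d = 0.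
    have := dker_linl k 1 0 0 d; rewrite scaler0 addr0 mul1r => /eqP.
    by rewrite -subr_eq0 opprD addrA subrr sub0r oppr_eq0 => /eqP.
  by rewrite -[z *: v]addr0 dker_linl d0 addr0.
by rewrite l dker_conj l rmorphM /= -dker_conj mulrA.
Qed.

Lemma dker_ge0 (u : seq (C * (findex * H))) : brehmer_positive T ->
  0 <= \sum_(p <- u) \sum_(r <- u) p.1 * (r.1)^* * dker p.2 r.2.
Proof.
move=> pos; pose S := undup (flatten [seq cover p.2.1 | p <- u]).
pose u' := [seq (fidx p.2.1, p.1 *: p.2.2) | p <- u].
have uS : uniq S := undup_uniq _.
have supp (p : C * (findex * H)) : p \in u -> supported S p.2.1.
  move=> pu; apply: supported_sub (@cover_supported _) => a ap.
  by rewrite mem_undup; apply/flattenP; exists (cover p.2.1) => //; apply: map_f.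
pose N := \max_(i <- u') \max_(b <- S) `|i.1 b|%N.
have hu i : i \in u' -> forall b, b \in S ->
    (b \notin S -> 0 <= i.1 b) /\ - N%:Z <= i.1 b <= - N%:Z + (N + N)%N%:Z.
  move=> iu b bS; split; first by rewrite bS.
  have : (`|i.1 b| <= N)%N.
    apply: (@leq_trans (\max_(b <- S) `|i.1 b|%N)).
      exact: (@leq_bigmax_seq _ _ xpredT (fun b => `|i.1 b|%N) _ bS isT).
    exact: (@leq_bigmax_seq _ _ xpredT
      (fun i : (L -> int) * H => \max_(b <- S) `|i.1 b|%N) _ iu isT).
  by rewrite -lez_nat abszE ler_norml PoszD => /andP[h1 h2]; rewrite h1 /=; lra.
have uS0 : uniq (S ++ [::]) by rewrite cats0.
(* All coordinates of [S] start at the minimum, and [p] is 0 off [S]. The coefficients were absorbed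
   into the vectors of [u'], and exponents range over [[-N, N]]. *)
have := @kap_ge0 S S [::] 0 _ _ u' pos uS (fun _ h => h) uS0 hu; congr (0 <= _).
rewrite /u' big_map; apply: eq_big_seq => p pu; rewrite big_map.
apply: eq_big_seq => r ru.
case: p pu => c [m x] pu; case: r ru => e [n y] ru /=.
rewrite -dker_scale (dkerE uS) /=; [|exact: (supp _ pu)|exact: (supp _ ru)].
have hp := supported_pmin (supp _ pu) (supp _ ru).
congr kap; apply/funext => b.
by case: ifPn => // /hp.
Qed.

(** * Shifts with phase and invariance of the kernel *)

Definition shift_index a (m : findex) : findex.
Proof.
exists (fidx m + delta a), (undup (a :: cover m)); split; first exact: undup_uniq.
apply: supportedD; last by apply: supported_delta; rewrite mem_undup mem_head.
apply: supported_sub (@cover_supported m) => b bm.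
by rewrite mem_undup inE bm orbT.
Defined.

Definition unshift_index a (m : findex) : findex.
Proof.
exists (fidx m - delta a), (undup (a :: cover m)); split; first exact: undup_uniq.
apply: supportedB; last by apply: supported_delta; rewrite mem_undup mem_head.
apply: supported_sub (@cover_supported m) => b bm.
by rewrite mem_undup inE bm orbT.
Defined.

Definition phase a (m : findex) : C := \prod_(b <- cover m) chi a b ^ m b.

Lemma phaseE S a (m : findex) : uniq S -> a \in S -> supported S m ->
  phase a m = cocycle S (delta a) m.
Proof.
move=> uS aS hm; rewrite cocycle_delta //.
apply: prod_uniq_support => //; first exact: cover_uniq.
  by move=> b /cover_supported ->.
by move=> b /hm ->.
Qed.

Lemma cocycle_delta_delta S a b : uniq S -> a \in S -> b \in S ->
  cocycle S (delta a) (delta b) = chi a b.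
Proof.
move=> uS aS bS; rewrite cocycle_delta // (bigD1_seq b) //= big1 ?mulr1.
  by rewrite /delta eqxx.
by move=> c cb; rewrite /delta (negPf cb).
Qed.

Lemma phase_norm a (m : findex) : `|phase a m| = 1.
Proof. by rewrite normr_prod big1 // => b _; apply: exprz_norm. Qed.

Lemma phase_shift a b (m : findex) : phase a (shift_index b m) = phase a m * chi a b.
Proof.
have [S [uS sub hm _]] := cover2 m m [:: a; b].
have aS : a \in S by apply: sub; rewrite mem_head.
have bS : b \in S by apply: sub; rewrite !inE eqxx orbT.
rewrite !(phaseE uS aS) //; last exact: supportedD (supported_delta bS).
by rewrite cocycleDr cocycle_delta_delta.
Qed.

(** The normalisation [chi a a = 1] lets shift and unshift carry conjugate phases, hence be
    inverse. *)
Lemma phase_unshift a (m : findex) : phase a (unshift_index a m) = phase a m.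
Proof.
have [S [uS sub hm _]] := cover2 m m [:: a].
have aS : a \in S by apply: sub; rewrite mem_head.
rewrite !(phaseE uS aS) //; last exact: supportedB (supported_delta aS).
by rewrite cocycleDr cocycleNr cocycle_delta_delta // chi_diag rmorph1 mulr1.
Qed.

Definition dshift a (d : findex * H) := (shift_index a d.1, phase a d.1 *: d.2).
Definition dunshift a (d : findex * H) :=
  (unshift_index a d.1, (phase a d.1)^* *: d.2).

Lemma dshiftK a : cancel (dshift a) (dunshift a).
Proof.
case=> m x; rewrite /dshift /dunshift /=; congr (_, _).
  by apply: findex_ext; rewrite /= addrK.
rewrite phase_shift chi_diag mulr1 scalerA mulrC unimodular_conj ?scale1r //.
exact: phase_norm.
Qed.

Lemma dunshiftK a : cancel (dunshift a) (dshift a).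
Proof.
case=> m x; rewrite /dshift /dunshift /=; congr (_, _).
  by apply: findex_ext; rewrite /= subrK.
rewrite phase_unshift scalerA unimodular_conj ?scale1r //.
exact: phase_norm.
Qed.

(** The minimum moves along with both exponents, so the differences are unchanged; each new
    bicharacter factor meets its conjugate. *)
Lemma dker_shift a d d' : dker (dshift a d) (dshift a d') = dker d d'.
Proof.
case: d d' => [m x] [n y].
have [S [uS sub hm hn]] := cover2 m n [:: a].
have aS : a \in S by apply: sub; rewrite mem_head.
have hd := supported_delta aS.
rewrite /dshift dker_scale /= !(phaseE uS aS) // (dkerE uS) /=;
  [|exact: supportedD|exact: supportedD].
rewrite (dkerE uS) // /kap /=.
have -> : pmin (fidx m + delta a) (fidx n + delta a) = pmin m n + delta a.
  by apply/funext => b; rewrite [RHS]addr_minl.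
have subE (r p : L -> int) : r + delta a - (p + delta a) = r - p.
  by rewrite opprD addrACA subrr addr0.
rewrite !subE; set p := pmin m n; set B := ip _ _.
rewrite !cocycleDl !cocycleDr !rmorphM /=.
have := unimodular_conj (cocycle_norm S p (delta a)).
have := unimodular_conj (cocycle_norm S (delta a) (delta a)).
have := unimodular_conj (cocycle_norm S (delta a) m).
have := unimodular_conj (cocycle_norm S (delta a) n).
set c1 := cocycle _ _ n; set c2 := cocycle _ _ m; set c3 := cocycle _ _ (delta a).
set c4 := cocycle _ p (delta a) => e1 e2 e3 e4.
transitivity ((c1 * c1^*) * (c2 * c2^*) * (c3 * c3^*) * (c4 * c4^*) *
  ((cocycle S p m)^* * cocycle S p n * B)); first by ring.
by rewrite e1 e2 e3 e4 !mul1r.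
Qed.

(** * The copy of the original space and the dilation *)

Lemma supp_zero : exists S, uniq S /\ supported S (0 : L -> int).
Proof. by exists [::]; split. Qed.

Definition findex0 : findex := Findex supp_zero.

Definition powT (m : findex) := wpow (cover m) m.

Lemma powTE S (m : findex) x : uniq S -> supported S m -> wpow S m x = powT m x.
Proof.
by move=> uS hm; apply: wpow_support => //; [exact: cover_uniq|exact: cover_supported].
Qed.

Lemma powTZ (m : findex) (c : C) x : powT m (c *: x) = c *: powT m x.
Proof. by apply: is_linearZ; exact: wop_linear. Qed.

(** Here [p = 0] and no phase remains. In the dilation this says that the adjoint of the embedding
    sends [phi (m, y)] to [T^m y]. *)
Lemma dker_origin (m : findex) x y : (forall b, 0 <= m b) ->
  dker (findex0, x) (m, y) = ip x (powT m y).
Proof.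
move=> m0; have uS := cover_uniq m; have hm := @cover_supported m.
rewrite (dkerE uS) //= /kap /=.
have -> : pmin 0 m = 0 by apply/funext => b; rewrite /pmin min_l.
have c0 n : cocycle (cover m) 0 n = 1.
  by rewrite /cocycle big1 // => a _; rewrite big1 // => b _; rewrite mul0r.
by rewrite !c0 conjC1 !mul1r !subr0 wpow0.
Qed.

Lemma powT_shift a (m : findex) x : (forall b, 0 <= m b) ->
  T a (powT m x) = powT (shift_index a m) (phase a m *: x).
Proof.
move=> m0; have [S [uS sub hm _]] := cover2 m m [:: a].
have aS : a \in S by apply: sub; rewrite mem_head.
rewrite -(powTE _ uS hm) wpow_apply // powTZ -(phaseE uS aS hm); congr (_ *: _).
by rewrite -(powTE (S := S)) //; apply: supportedD => //; exact: supported_delta.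
Qed.

(** [J] embeds [H] at exponent zero; [J \o Jadj] is the orthogonal projection onto its range, so
    [Jadj] expresses compression to [H]. *)
Theorem brehmer_dilation : brehmer_positive T ->
  exists (K : hilbert R) (J : H -> K) (Jadj : K -> H) (U : L -> K -> K),
    [/\ isometry_op J, is_adjoint J Jadj, forall a, unitary (U a), q_commuting q U &
      forall s x, word_op T s x = Jadj (word_op U s (J x))].
Proof.
move=> pos.
have [K [phi [gram total trans]]] :=
  kolmogorov_decomposition dker_conj (fun u => dker_ge0 u pos).
have /choice[U hU] (a : L) :
    exists U : K -> K, unitary U /\ forall d, U (phi d) = phi (dshift a d).
  have [U U1 U2] := trans _ _ (dshiftK a) (dunshiftK a) (dker_shift a).
  by exists U.
have phi_lin (m : findex) (c : C) x y :
    phi (m, c *: x + y) = c *: phi (m, x) + phi (m, y).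
  by apply: total => d; rewrite ipDl ipZl !gram dker_linl.
have phiZ (m : findex) (c : C) x : phi (m, c *: x) = c *: phi (m, x).
  exact: (is_linearZ (f := fun y => phi (m, y)) c x (phi_lin m)).
pose J x := phi (findex0, x).
have Jiso : isometry_op J.
  split; first by move=> c x y; exact: phi_lin.
  move=> x y; rewrite gram dker_origin //.
  by rewrite -(@powTE [::]) // wpow0.
have Jle x : ip (J x) (J x) <= ip x x by rewrite Jiso.2.
have [Jadj hJ] := adjoint_exists Jiso.1 Jle.
exists K, J, Jadj, U; split=> //; first by move=> a; case: (hU a).
- move=> a b ab f.
  have gen d : U a (U b (phi d)) = q a b *: U b (U a (phi d)).
    rewrite !(proj2 (hU _)) /dshift /= -phiZ; congr phi; congr (_, _).
      by apply: findex_ext; rewrite /= addrAC.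
    by rewrite !phase_shift !scalerA (chi_q ab); congr (_ *: _); ring.
  have q1 : `|q a b| = 1.
    by have := chi_norm a b; rewrite (chi_q ab) normrM chi_norm mulr1.
  have iso c g h : ip (U c g) (U c h) = ip g h by case: (hU c) => -[[_ ->]].
  (* Test against [phi d = U a (U b (phi d'))]: the unitaries cancel on both sides, leaving the
     factor [|q a b|^2 = 1] on the right. *)
  apply: total => d.
  have [d' <-] : exists d', U a (U b (phi d')) = phi d.
    exists (dunshift b (dunshift a d)).
    by rewrite !(proj2 (hU _)) !dunshiftK.
  by rewrite [in RHS]gen !iso ipZl ipZr !iso mulrA unimodular_conj // mul1r.
- move=> s x.
  (* Invariant along a word: the image of [J x] stays a single vector [phi (m, z)] with [m >= 0],
     where [T^m z] is the word in the [T a] applied to [x]. *)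
  suff [m [z [m0 -> <-]]] : exists (m : findex) z,
      [/\ forall b, 0 <= m b, word_op U s (J x) = phi (m, z) & powT m z = word_op T s x].
    apply: ip_ext => y; rewrite -hJ gram dker_origin //.
  elim: s => [|[a k] s [m [z [m0 e1 e2]]]] /=.
    by exists findex0, x; split=> //; rewrite -(@powTE [::]) // wpow0.
  elim: k => [|k [m' [z' [m0' e1' e2']]]] /=; first by exists m, z.
  exists (shift_index a m'), (phase a m' *: z'); split.
  + move=> b; apply: addr_ge0; first exact: m0'.
    by rewrite /delta; case: eqP.
  + by rewrite e1' (proj2 (hU a)).
  + by rewrite -powT_shift // e2'.
Qed.

End TwistedWords.

(** * Choice of the phases and conclusion *)

Lemma twist_exists (R : realType) (L : eqType) (q : L -> L -> R[i]) :
  (forall a b, a <> b -> `|q a b| = 1 /\ q a b = (q b a)^-1) ->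
  exists chi : L -> L -> R[i],
    [/\ forall a b, `|chi a b| = 1, forall a, chi a a = 1 &
        forall a b, a <> b -> chi a b = q a b * chi b a].
Proof.
move=> hq; have [le wo] := well_ordering_principle L.
(* Each nonempty subset has a unique least element. For a pair, existence gives totality and
   uniqueness gives antisymmetry. *)
have tot a b : le a b || le b a.
  have [|z [[zab lez] _]] := wo [pred x | x \in [:: a; b]].
    by exists a; rewrite !inE eqxx.
  have := lez a; have := lez b; rewrite !inE !eqxx orbT /= => /(_ isT) l1 /(_ isT) l2.
  by move: zab; rewrite !inE => /orP[]/eqP zE; move: l1 l2; rewrite zE => l1 l2;
    rewrite ?l1 ?l2 ?orbT.
have anti a b : le a b -> le b a -> a = b.
  move=> lab lba; have [|z [_ uz]] := wo [pred x | x \in [:: a; b]].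
    by exists a; rewrite !inE eqxx.
  have refl c : le c c by have := tot c c; rewrite orbb.
  have -> : a = z.
    apply/esym/uz; split; first by rewrite !inE eqxx.
    by move=> c; rewrite !inE => /orP[]/eqP->.
  apply: uz; split; first by rewrite !inE eqxx orbT.
  by move=> c; rewrite !inE => /orP[]/eqP->.
(* Each unordered pair carries its whole phase on its increasing ordering. *)
exists (fun a b => if (a == b) || ~~ le a b then 1 else q a b); split.
- move=> a b; case: ifPn => [_|]; first exact: normr1.
  by rewrite negb_or => /andP[/eqP/hq[]].
- by move=> a; rewrite eqxx.
- move=> a b ab; rewrite eq_sym; case: eqVneq => [/esym //|ba] /=.
  have [q1 q2] := hq a b ab.
  have [lab|nab] := boolP (le a b); have [lba|nba] := boolP (le b a) => /=.
  + by case: ab; exact: anti.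
  + by rewrite mulr1.
  + by rewrite q2 mulVr // unimodular_unit // (hq _ _ (fun e => ab (esym e))).1.
  + by have := tot a b; rewrite (negPf nab) (negPf nba).
Qed.

Lemma In_mem (L : eqType) (a : L) (s : seq L) : List.In a s -> a \in s.
Proof.
elim: s => //= b s IH [->|/IH as_]; first exact: mem_head.
by rewrite inE as_ orbT.
Qed.

Lemma uniq_NoDup (L : eqType) (s : seq L) : uniq s -> List.NoDup s.
Proof.
elim: s => [|a s IH] /=; first by constructor.
by move=> /andP[/negP as_ /IH h]; constructor=> // /In_mem.
Qed.

Local Open Scope complex_scope.

Theorem theorem5p2 (R : realType) (H : hilbert R) (Lam : Type)
  (q : Lam -> Lam -> R[i]) (T : Lam -> H -> H) :
  (forall a b, a <> b -> `|q a b| = 1 /\ q a b = (q b a)^-1) ->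
  (forall a, contraction (T a)) ->
  q_commuting q T ->
  ( (forall a, isometry_op (T a))
    \/ (forall a b, a <> b -> forall Tbs : H -> H, is_adjoint (T b) Tbs ->
          forall x, T a (Tbs x) = (q a b)^* *: Tbs (T a x))
    \/ (countable [set: Lam]%classic /\
        forall s : seq Lam, List.NoDup s -> \sum_(a <- s) opnorm (T a) ^+ 2 <= 1) ) ->
  exists (K : hilbert R) (J : H -> K) (Jadj : K -> H) (U : Lam -> K -> K),
    isometry_op J /\ is_adjoint J Jadj /\
    (forall a, unitary (U a)) /\ q_commuting q U /\
    forall s : seq (Lam * nat)%type, List.NoDup (map fst s) ->
      forall x, word_op T s x = Jadj (word_op U s (J x)).
Proof.
move=> hq hT Tq hyp.
(* [{classic Lam}] equips the bare type [Lam] with the decidable equality used throughout. *)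
have [chi [chi1 chid chiq]] := @twist_exists R {classic Lam} q hq.
have pos : @brehmer_positive R H {classic Lam} T.
  case: hyp => [iso|[dc|[_ sum1]]].
  - exact: (@isometry_brehmer_positive R H {classic Lam} T iso).
  - exact: (@doubly_commuting_brehmer_positive R H {classic Lam} T hT q Tq dc).
  - apply: (@row_contraction_brehmer_positive R H {classic Lam} T hT) => F /uniq_NoDup.
    exact: sum1.
have [K [J [Jadj [U [h1 h2 h3 h4 h5]]]]] :=
  @brehmer_dilation R H {classic Lam} T q chi hT Tq chi1 chid chiq pos.
by exists K, J, Jadj, U; split=> //; split=> //; split=> //; split.
Qed.
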